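(* Let $K$ be an infinite field of characteristic different from $2$ and $3$; all algebras are over $K$. (a) Each finitely generated Bernstein algebra which is algebraic of bounded degree $\le 2$ is finite-dimensional. (b) For each $d\ge 3$ and $n\ge 2$, there exists an infinite-dimensional $n$-generated Bernstein algebra which is algebraic of bounded degree $d$. (c) For each $d\ge 3$ and $n\ge 2$, there exists an infinite-dimensional $n$-generated Bernstein algebra which is a train algebra of rank $d+1$.
   Context: Algebras are not assumed associative, unital or finite-dimensional. A Bernstein algebra over $K$ is a commutative $K$-algebra $A$ with a nonzero algebra homomorphism $\omega:A\to K$ satisfying $(x^2)^2=\omega(x)^2x^2$ for all $x$. An algebra is finitely generated ($n$-generated) if it is generated as an algebra by a finite subset (of $n$ elements). An element $a$ is algebraic of degree $\deg(a)=\dim\mathrm{alg}(a)$ if the subalgebra $\mathrm{alg}(a)$ generated by $a$ is finite-dimensional. $A$ is algebraic of bounded degree if all elements are algebraic with degrees bounded collectively; its bounded degree is $\min\{n\ge 1: \deg(a)\le n\ \forall a\in A\}$. Principal powers: $x^1=x$, $x^{k+1}=x^kx$. A commutative algebra with weight function $\omega$ is a train algebra of rank $r$ if there are $\gamma_1,\dots,\gamma_{r-1}\in K$ with $x^r+\gamma_1\omega(x)x^{r-1}+\cdots+\gamma_{r-1}\omega(x)^{r-1}x=0$ for all $x\in A$, where $r\ge2$ is the smallest integer for which such an equation holds. *)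

(* Defs.v *)
From HB Require Import structures.
From mathcomp Require Import all_boot all_algebra.
From mathcomp Require Import boolp classical_sets functions cardinality.
Set Implicit Arguments.
Unset Strict Implicit.
Unset Printing Implicit Defensive.
Import GRing.Theory.
Local Open Scope classical_set_scope.
Local Open Scope card_scope.
Local Open Scope ring_scope.

(* Neither associativity, nor a unit, nor finite dimension is assumed, so the
   algebra structures of ssralg do not apply. *)
Record nalg (K : fieldType) := NAlg {
  nalg_sort :> lmodType K;
  amul : {bilinear nalg_sort -> nalg_sort -> nalg_sort} }.

Section Algebras.
Variables (K : fieldType) (A : nalg K).
Implicit Types (U S : set A) (w : {scalar A}) (x a : A).

Local Notation "x ** y" := (amul A x y) (at level 40, left associativity).

Definition is_basis U n (e : 'I_n -> A) : Prop :=
  (forall v, U v <-> exists c : 'I_n -> K, v = \sum_(i < n) c i *: e i) /\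
  (forall c : 'I_n -> K, \sum_(i < n) c i *: e i = 0 -> forall i, c i = 0).

Definition has_dim U (n : nat) : Prop := exists e : 'I_n -> A, is_basis U e.

Definition finite_dimensional U : Prop := exists n, has_dim U n.

Definition is_subalgebra U : Prop :=
  [/\ U 0,
      forall x y, U x -> U y -> U (x + y),
      forall (k : K) x, U x -> U (k *: x)
    & forall x y, U x -> U y -> U (x ** y)].

Definition alg_gen S : set A := smallest is_subalgebra S.

Definition finitely_generated : Prop :=
  exists S, finite_set S /\ alg_gen S = [set: A].

Definition n_generated (n : nat) : Prop :=
  exists S, S #= `I_n /\ alg_gen S = [set: A].

(* deg(a) = n; the degree is defined only for algebraic elements. *)
Definition has_degree a (n : nat) : Prop := has_dim (alg_gen [set a]) n.

Definition degrees_le (n : nat) : Prop :=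
  forall a, exists2 m, has_degree a m & (m <= n)%N.

Definition bounded_degree (d : nat) : Prop :=
  [/\ (1 <= d)%N, degrees_le d
    & forall n, (1 <= n)%N -> degrees_le n -> (d <= n)%N].

Definition is_commutative : Prop := forall x y, x ** y = y ** x.

Definition is_weight w : Prop :=
  (forall x y, w (x ** y) = w x * w y) /\ exists x, w x != 0.

Definition is_bernstein w : Prop :=
  [/\ is_commutative, is_weight w
    & forall x, (x ** x) ** (x ** x) = w x ^+ 2 *: (x ** x)].

(* x^k for k >= 1; the value x at k = 0 is a dummy. *)
Definition ppow x (k : nat) : A := iter k.-1 (fun y => y ** x) x.

Definition train_equation w (r : nat) : Prop :=
  exists gamma : nat -> K, forall x,
    ppow x r + \sum_(1 <= i < r) (gamma i * w x ^+ i) *: ppow x (r - i) = 0.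

Definition is_train w (r : nat) : Prop :=
  [/\ is_commutative, is_weight w, (2 <= r)%N, train_equation w r
    & forall s, (2 <= s)%N -> train_equation w s -> (r <= s)%N].

End Algebras.

(* Main.v *)
Require Import Defs.
From HB Require Import structures.
From mathcomp Require Import all_boot all_algebra.
From mathcomp Require Import boolp classical_sets functions cardinality.
From mathcomp Require Import ring.
Set Implicit Arguments.
Unset Strict Implicit.
Unset Printing Implicit Defensive.
Import GRing.Theory.
Local Open Scope classical_set_scope.
Local Open Scope ring_scope.

(* (a) Let A = Ke + U + V be the Peirce decomposition at an idempotent e. Degree
   at most 2 forces V V = 0 and (u v) v = 0; together with u u u = 0 and
   u (u v) = 0 this makes a (b v) skew in a, b in U, makes (a v) v' skew in
   v, v' in V, and gives a Jacobi identity a (b c) + b (c a) + c (a b) = 0 on U.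
   Let u_1, .., u_m be the U-components of the generators and W the finite set of
   their V-components and of the products u_i u_j. Then U is spanned by the trees
   obtained from the u_i by the operations z |-> z w (w in W) and
   (z, y) |-> z (u_k y). A tree with n operations of the second kind carries
   2n+1 labels u_i and is skew in them modulo trees with fewer such operations,
   hence n < m can be assumed; for bounded n the trees span a finite-dimensional
   space since the operators z |-> z w anticommute.

   (b), (c) Take A = K + M + K^2 where M has two operators a, b, the products
   M M and K^2 K^2 vanish, and (s, t) in K^2 acts on M by R = s a + t b. Every
   such A is Bernstein. If x has weight c and components u, R, then
   x^3 - c x^2 = 2 R^2 u and x acts on M by c/2 + R, so R^d = 0 for all (s, t)
   bounds the degree by d and the rank by d+1. An infinite-dimensional cyclic M
   comes from the nilpotent pencil a : e1 -> e2 -> e3 -> 0, b : e1 -> 0,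
   e2 -> t e1, e3 -> - t e2 over K[t], preceded by a chain of length d-3. *)

(** * Linear algebra *)

(* Proof by reflection of linear identities in a module: both sides are compared
   coefficientwise on their atoms. *)
Section LinearExpressions.
Variables (K : fieldType) (V : lmodType K).

Inductive lexp :=
| LAtom of nat | LZero | LAdd of lexp & lexp | LOpp of lexp
| LScale of K & lexp | LMuln of lexp & nat.

Fixpoint leval (env : seq V) (e : lexp) : V :=
  match e with
  | LAtom i => env`_i
  | LZero => 0
  | LAdd e1 e2 => leval env e1 + leval env e2
  | LOpp e1 => - leval env e1
  | LScale k e1 => k *: leval env e1
  | LMuln e1 n => leval env e1 *+ n
  end.

Fixpoint lcoef (e : lexp) (j : nat) : K :=
  match e with
  | LAtom i => if eqn i j then 1 else 0
  | LZero => 0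
  | LAdd e1 e2 => lcoef e1 j + lcoef e2 j
  | LOpp e1 => - lcoef e1 j
  | LScale k e1 => k * lcoef e1 j
  | LMuln e1 n => lcoef e1 j * n%:R
  end.

Fixpoint lcoef_eq (e1 e2 : lexp) (n : nat) : Prop :=
  if n is n'.+1 then lcoef e1 n' = lcoef e2 n' /\ lcoef_eq e1 e2 n' else True.

Lemma levalE env e : leval env e = \sum_(j < size env) lcoef e j *: env`_j.
Proof.
elim: e => [i||e1 IH1 e2 IH2|e IH|k e IH|e IH n] /=.
- have [lt_i|le_i] := ltnP i (size env).
    rewrite (bigD1 (Ordinal lt_i)) //= -[eqn i i]/(i == i) eqxx scale1r big1 ?addr0 // => j.
    by rewrite -val_eqE /= -[eqn i j]/(i == j :> nat) eq_sym => /negbTE->; rewrite scale0r.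
  rewrite nth_default // big1 // => j _; rewrite -[eqn i j]/(i == j :> nat).
  by rewrite gtn_eqF ?scale0r // (leq_trans (ltn_ord j)).
- by rewrite big1 // => j _; rewrite scale0r.
- by rewrite IH1 IH2 -big_split; apply: eq_bigr => j _; rewrite scalerDl.
- by rewrite IH -sumrN; apply: eq_bigr => j _; rewrite scaleNr.
- by rewrite IH scaler_sumr; apply: eq_bigr => j _; rewrite scalerA.
- rewrite IH -sumrMnl; apply: eq_bigr => j _.
  by rewrite mulr_natr scalerMnl.
Qed.

Lemma lcoef_eqP env e1 e2 :
  lcoef_eq e1 e2 (size env) -> leval env e1 = leval env e2.
Proof.
rewrite !levalE; move: (size env) => n; elim: n => [|n IH] /=.
  by rewrite !big_ord0.
by case=> eq_n /IH; rewrite !big_ord_recr /= eq_n => ->.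
Qed.

End LinearExpressions.

Ltac lindex x env :=
  lazymatch env with
  | x :: _ => constr:(0%N)
  | _ :: ?env' => let i := lindex x env' in constr:(i.+1)
  end.

Ltac latoms t env :=
  lazymatch t with
  | (?x + ?y)%R => let env' := latoms x env in latoms y env'
  | (- ?x)%R => latoms x env
  | (_ *: ?x)%R => latoms x env
  | (?x *+ _)%R => latoms x env
  | 0%R => env
  | _ => match env with
         | _ => let _ := lindex t env in env
         | _ => constr:(t :: env)
         end
  end.

Ltac lreify K t env :=
  lazymatch t with
  | (?x + ?y)%R => let a := lreify K x env in let b := lreify K y env in
                   constr:(@LAdd K a b)
  | (- ?x)%R => let a := lreify K x env in constr:(@LOpp K a)
  | (?k *: ?x)%R => let a := lreify K x env in constr:(@LScale K k a)
  | (?x *+ ?n)%R => let a := lreify K x env in constr:(@LMuln K a n)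
  | 0%R => constr:(@LZero K)
  | _ => let i := lindex t env in constr:(@LAtom K i)
  end.

Ltac lmodule_eq K V solver :=
  lazymatch goal with
  | |- ?x = ?y =>
      let env := latoms x (@nil V) in let env := latoms y env in
      let a := lreify K x env in let b := lreify K y env in
      change (@leval K V env a = @leval K V env b);
      apply: lcoef_eqP; cbn [lcoef_eq lcoef eqn size];
      repeat split; solver
  end.

Section Spans.
Variables (K : fieldType) (V : lmodType K).
Implicit Types (s : seq V) (v : V).

(** Membership in the span peels off one multiple per entry of the list, so that the facts below
    follow by induction on [s]. *)
Fixpoint inspan s v : Prop :=
  if s is x :: s' then exists c : K, inspan s' (v - c *: x) else v = 0.

Lemma inspan0 s : inspan s 0.
Proof. by elim: s => //= x s IH; exists 0; rewrite scale0r subr0. Qed.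

Lemma inspanD s u v : inspan s u -> inspan s v -> inspan s (u + v).
Proof.
elim: s u v => [|x s IH] u v /=; first by move=> -> ->; rewrite addr0.
move=> [c Hu] [d Hv]; exists (c + d).
by rewrite scalerDl opprD addrACA; apply: IH.
Qed.

Lemma inspanZ s k v : inspan s v -> inspan s (k *: v).
Proof.
elim: s v => [|x s IH] v /=; first by move=> ->; rewrite scaler0.
by move=> [c Hv]; exists (k * c); rewrite -scalerA -scalerBr; apply: IH.
Qed.

Lemma inspanN s v : inspan s v -> inspan s (- v).
Proof. by rewrite -scaleN1r; apply: inspanZ. Qed.

Lemma inspan_cons x s v : inspan s v -> inspan (x :: s) v.
Proof. by move=> Hv; exists 0; rewrite scale0r subr0. Qed.

Lemma inspan_mem s v : v \in s -> inspan s v.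
Proof.
elim: s => //= x s IH; rewrite inE => /predU1P[->|/IH Hv].
  by exists 1; rewrite scale1r subrr; apply: inspan0.
exact: inspan_cons.
Qed.

Lemma inspan_min (P : V -> Prop) s :
  P 0 -> (forall u v, P u -> P v -> P (u + v)) ->
  (forall k u, P u -> P (k *: u)) -> (forall x, x \in s -> P x) ->
  forall v, inspan s v -> P v.
Proof.
move=> P0 PD PZ; elim: s => [|x s IH] Ps v /=; first by move=> ->.
case=> c Hv; rewrite -(subrK (c *: x) v); apply: PD.
  by apply: IH Hv => y ys; apply: Ps; rewrite inE ys orbT.
by apply/PZ/Ps; rewrite mem_head.
Qed.

Lemma inspan_sub s s' : (forall x, x \in s -> inspan s' x) ->
  forall v, inspan s v -> inspan s' v.
Proof.
by apply: inspan_min; [exact: inspan0 | exact: inspanD | exact: inspanZ].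
Qed.

Lemma inspan_comb s n (c : 'I_n -> K) (e : 'I_n -> V) :
  (forall i, inspan s (e i)) -> inspan s (\sum_(i < n) c i *: e i).
Proof.
move=> He; elim/big_ind: _ => [|u v|i _]; first exact: inspan0.
  exact: inspanD.
exact: inspanZ.
Qed.

(** The coefficient matrix has more rows than columns, so its left kernel contains a nonzero row. *)
Lemma dependent_family n m (e : 'I_n -> V) (f : 'I_m -> V) :
  (forall j, exists c : 'I_n -> K, f j = \sum_(i < n) c i *: e i) ->
  (n < m)%N ->
  exists2 r : 'I_m -> K, exists j, r j != 0 & \sum_(j < m) r j *: f j = 0.
Proof.
move=> /choice[C fE] lt_nm; pose M := \matrix_(j < m, i < n) C j i.
have: kermx M != 0.
  rewrite kermx_eq0 -row_leq_rank -ltnNge.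
  exact: leq_ltn_trans (rank_leq_col M) lt_nm.
case/rowV0Pn => r /sub_kermxP rM0 r_neq0; exists (fun j => r 0 j).
  apply/existsP; apply: contraNT r_neq0; rewrite negb_exists => /forallP r0.
  by apply/eqP/rowP => j; rewrite mxE; apply/eqP/negbNE/r0.
transitivity (\sum_(i < n) (\sum_(j < m) r 0 j * C j i) *: e i).
  under eq_bigr do rewrite fE scaler_sumr.
  rewrite exchange_big; apply: eq_bigr => i _; rewrite scaler_suml.
  by apply: eq_bigr => j _; rewrite scalerA.
rewrite big1 // => i _; have /rowP/(_ i) := rM0; rewrite !mxE => rM0i.
suff -> : \sum_(j < m) r 0 j * C j i = 0 by rewrite scale0r.
by rewrite -[RHS]rM0i; apply: eq_bigr => j _; rewrite mxE.
Qed.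

End Spans.

(** * Dimension of subspaces of a finite span *)

Section Dimension.
Variables (K : fieldType) (A : nalg K).
Implicit Types (U : set A) (s : seq A).

(** Induction on [s]: the part of [U] in the span of the tail has a basis, and at most one vector of
    [U] outside that span has to be added. *)
Lemma subspace_has_dim U s :
  U 0 -> (forall x y, U x -> U y -> U (x + y)) ->
  (forall (k : K) x, U x -> U (k *: x)) ->
  (forall x, U x -> inspan s x) -> exists2 m, has_dim U m & (m <= size s)%N.
Proof.
elim: s U => [|a s IH] U U0 UD UZ Us.
  exists 0%N => //; exists (fun=> 0); split=> [v|c _ []//]; split=> [/Us/= ->|].
    by exists (fun=> 0); rewrite big_ord0.
  by case=> c ->; rewrite big_ord0.
have [|||v []//|m [e [eU e_free]] le_ms] := IH [set x | U x /\ inspan s x].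
- by split=> //; apply: inspan0.
- by move=> x y [? ?] [? ?]; split; [apply: UD | apply: inspanD].
- by move=> k x [? ?]; split; [apply: UZ | apply: inspanZ].
have [sU|] := pselect (forall x, U x -> inspan s x).
  exists m; last exact: leqW.
  exists e; split=> // v; rewrite -eU; split=> [Uv|[]//]; split=> //.
  exact: sU.
move/existsNP => [y /not_implyP[Uy sNy]].
have [k /= sy] := Us _ Uy.
have k_neq0 : k != 0.
  by apply/eqP => k0; apply: sNy; rewrite k0 scale0r subr0 in sy.
pose f i := if unlift ord0 i is Some j then e j else y.
have fE c : \sum_i c i *: f i = c ord0 *: y + \sum_j c (lift ord0 j) *: e j.
  rewrite big_ord_recl /f unlift_none; congr (_ + _).
  by apply: eq_bigr => j _; rewrite liftK.
have eV c : U (\sum_j c j *: e j) /\ inspan s (\sum_j c j *: e j).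
  by apply/eU; exists c.
exists m.+1 => //; exists f; split=> [v|c]; last first.
  rewrite fE => fc0; suff c0 : c ord0 = 0.
    move: fc0; rewrite c0 scale0r add0r => /e_free ec0 i.
    by case: (unliftP ord0 i) => [j|] ->.
  apply/eqP; apply: contra_notT sNy => c_neq0.
  have -> : y = - (c ord0)^-1 *: \sum_j c (lift ord0 j) *: e j.
    have -> : \sum_j c (lift ord0 j) *: e j = - c ord0 *: y.
      by apply/eqP; rewrite scaleNr -addr_eq0 addrC fc0.
    by rewrite scalerA mulrNN mulVf ?scale1r.
  by apply: inspanZ; case: (eV (c \o lift ord0)).
split=> [Uv|[c ->]]; last first.
  by rewrite fE; apply: UD; [apply: UZ | case: (eV (c \o lift ord0))].
have [l /= sv] := Us _ Uv.
have [c cE] : exists c : 'I_m -> K, v - (l / k) *: y = \sum_j c j *: e j.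
  apply/eU; split; first by apply: UD => //; rewrite -scaleNr; apply: UZ.
  (* The factor l / k cancels the [a]-coordinate of [v] against that of [y]. *)
  have -> : v - (l / k) *: y = (v - l *: a) - (l / k) *: (y - k *: a).
    lmodule_eq K (A : Type) ltac:(field; exact: k_neq0).
  by apply: inspanD => //; apply/inspanN/inspanZ.
exists (fun i => if unlift ord0 i is Some j then c j else l / k).
rewrite fE unlift_none; under eq_bigr do rewrite liftK.
by rewrite -cE addrC subrK.
Qed.

Lemma finite_dimensionalP : finite_dimensional [set: A] <->
  exists s, forall x, inspan s x.
Proof.
split=> [[n [e [eP _]]]|[s As]].
  exists (codom e) => x; have [c ->] := (eP x).1 I.
  by apply: inspan_comb => i; apply/inspan_mem/codom_f.
by have [m ? _] := @subspace_has_dim setT s I (fun _ _ _ _ => I) (fun _ _ _ => I)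
  (fun x _ => As x); exists m.
Qed.

Lemma independent_le_dim U n m (f : 'I_m -> A) :
  has_dim U n -> (forall j, U (f j)) ->
  (forall r : 'I_m -> K, \sum_(j < m) r j *: f j = 0 -> forall j, r j = 0) ->
  (m <= n)%N.
Proof.
move=> [e [eU _]] Uf f_free; rewrite leqNgt; apply/negP => lt_nm.
have [|r [j /eqP]] := dependent_family _ lt_nm (e := e) (f := f).
  by move=> j; apply/eU.
by move=> + r0; apply; apply: f_free.
Qed.

End Dimension.

(** * Trees spanning the Peirce component U *)

Section AlternatingTrees.
Variables (K : fieldType) (A : nalg K) (two_neq0 : 2%:R != 0 :> K).
Local Notation "x ** y" := (amul A x y) (at level 40, left associativity).
Variables (U V : set A).
Hypotheses (mulC : is_commutative A)
  (U0 : U 0) (UD : forall x y, U x -> U y -> U (x + y))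
  (UZ : forall (k : K) x, U x -> U (k *: x)).
Hypotheses (UUV : forall a b, U a -> U b -> V (a ** b))
  (UVU : forall a v, U a -> V v -> U (a ** v))
  (UUV_skew : forall a b v, U a -> U b -> V v -> a ** (b ** v) = - (b ** (a ** v)))
  (UVV_skew : forall a v v', U a -> V v -> V v' -> (a ** v) ** v' = - ((a ** v') ** v))
  (UUU_jacobi : forall a b c, U a -> U b -> U c ->
     a ** (b ** c) = - (b ** (a ** c)) - c ** (a ** b)).
Variables (m : nat) (u : 'I_m -> A) (I : finType) (W : I -> A).
Hypotheses (Uu : forall i, U (u i)) (VW : forall i, V (W i))
  (Wuu : forall i j, exists k, W k = u i ** u j).

(* A tree denotes an element of U once its leaves are labelled by generators:
   [App t i] is [t * W i] and [Big z y] is [z * (u_k * y)]. The labels of a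
   subtree are the values of [rho] on the interval of length [nlabels] starting at
   the offset [o]; the label [k] of [Big z y] sits between those of [z] and [y].
   [spine t rho o] is the dependence on the head label [rho o], which is linear. *)
Inductive tree := Leaf | App of tree & I | Big of tree & tree.

Fixpoint nlabels t :=
  match t with
  | Leaf => 1
  | App t _ => nlabels t
  | Big z y => nlabels z + (nlabels y).+1
  end%N.

Fixpoint nbig t :=
  match t with Leaf => 0 | App t _ => nbig t | Big z y => (nbig z + nbig y).+1 end%N.

Fixpoint spine t (rho : nat -> 'I_m) o (x : A) : A :=
  match t with
  | Leaf => x
  | App t i => spine t rho o x ** W i
  | Big z y => let k := (o + nlabels z)%N in
      spine z rho o x ** (u (rho k) ** spine y rho k.+1 (u (rho k.+1)))
  end.

Definition teval t rho o := spine t rho o (u (rho o)).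

Lemma nlabelsE t : nlabels t = (nbig t).*2.+1.
Proof. by elim: t => //= z -> y ->; rewrite doubleS doubleD !addnS !addSn. Qed.

Lemma spine_ext t rho rho' o o' x :
  (forall i, (0 < i < nlabels t)%N -> rho (o + i)%N = rho' (o' + i)%N) ->
  spine t rho o x = spine t rho' o' x.
Proof.
elim: t rho rho' o o' x => //= [t IH i|z IHz y IHy] rho rho' o o' x eq_rho.
  by rewrite (IH _ rho' _ o').
have nlz : (0 < nlabels z)%N by rewrite nlabelsE.
have nly : (0 < nlabels y)%N by rewrite nlabelsE.
have eqz i : (0 < i < nlabels z)%N -> rho (o + i)%N = rho' (o' + i)%N.
  by move=> /andP[i0 iz]; apply: eq_rho; rewrite i0 ltn_addr.
have eqy i : (i < (nlabels y).+1)%N -> rho (o + nlabels z + i)%N = rho' (o' + nlabels z + i)%N.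
  by move=> iy; rewrite -!addnA eq_rho // addn_gt0 nlz ltn_add2l.
rewrite (IHz _ rho' _ o' x eqz).
have := eqy 0; rewrite !addn0 => -> //; have := eqy 1; rewrite !addn1 => -> //.
rewrite (IHy _ rho' _ (o' + nlabels z).+1 _) // => i /andP[_ iy].
by rewrite !addSnnS eqy.
Qed.

Lemma teval_ext t rho rho' o o' :
  (forall i, (i < nlabels t)%N -> rho (o + i)%N = rho' (o' + i)%N) ->
  teval t rho o = teval t rho' o'.
Proof.
move=> eq_rho; rewrite /teval (spine_ext (rho' := rho') (o' := o')).
  by have := eq_rho 0; rewrite !addn0 => -> //; rewrite nlabelsE.
by move=> i /andP[_]; apply: eq_rho.
Qed.

Lemma teval_App t i rho o : teval (App t i) rho o = teval t rho o ** W i.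
Proof. by []. Qed.

Lemma teval_Big z y rho o : teval (Big z y) rho o =
  teval z rho o ** (u (rho (o + nlabels z)) ** teval y rho (o + nlabels z).+1)%N.
Proof. by []. Qed.

Lemma spine_U t rho o x : U x -> U (spine t rho o x).
Proof.
elim: t rho o x => //= [t IH i|z IHz y IHy] rho o x Ux; apply: UVU => //.
- exact: IH.
- exact: IHz.
- by apply: UUV => //; apply: IHy.
Qed.

Lemma teval_U t rho o : U (teval t rho o).
Proof. exact: spine_U. Qed.

Lemma spineD t rho o x y :
  spine t rho o (x + y) = spine t rho o x + spine t rho o y.
Proof.
by elim: t rho o => //= [t IH i|z IHz y' _] rho o; rewrite ?IH ?IHz linearDl.
Qed.

(** Parity of the number of steps along the spine. Each step multiplies by an element of [V] and
    contributes one sign in [spine_mulV]. *)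
Fixpoint tsgn t : bool :=
  match t with Leaf => false | App t _ => ~~ tsgn t | Big z _ => ~~ tsgn z end.

Lemma spine_mulV t rho o x v : U x -> V v ->
  spine t rho o x ** v = (-1) ^+ tsgn t *: spine t rho o (x ** v).
Proof.
move=> Ux Vv; elim: t rho o => /= [|t IH i|z IHz y _] rho o; rewrite ?expr0 ?scale1r //.
  rewrite UVV_skew ?IH //; last exact: spine_U.
  by rewrite linearZl_LR signrN scaleNr.
rewrite UVV_skew ?IHz //; [|exact: spine_U|exact/UUV/spine_U].
by rewrite linearZl_LR signrN scaleNr.
Qed.

(** The sign with which the spine operator is self-adjoint for the product of [U] with itself into
    [V]. *)
Fixpoint teps t : bool :=
  match t with
  | Leaf => false
  | App t _ => ~~ (teps t (+) tsgn t)
  | Big z _ => ~~ (teps z (+) tsgn z)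
  end.

Let adjoint z := forall rho o a b, U a -> U b ->
  a ** spine z rho o b = (-1 : K) ^+ teps z *: (b ** spine z rho o a).

(** [UUV_skew] turns the left side into minus the product of av with the spine at b; the hypothesis
    moves the spine onto av, and [spine_mulV] pulls v out again. *)
Lemma spine_adj_step z v rho o a b : U a -> U b -> V v -> adjoint z ->
  a ** (spine z rho o b ** v) =
    (-1 : K) ^+ (~~ (teps z (+) tsgn z)) *: (b ** (spine z rho o a ** v)).
Proof.
move=> Ua Ub Vv IH; have Us := spine_U z rho o Ub.
rewrite UUV_skew // mulC IH ?spine_mulV //; last exact: UVU.
by rewrite linearZr_LR scalerA -scaleNr signrN signr_addb mulNr -mulrA -signr_addb addbb mulr1.
Qed.

Lemma spine_adj t : adjoint t.
Proof.
elim: t => /= [|t IH i|z IHz y _] rho o a b Ua Ub; first by rewrite scale1r mulC.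
  exact: spine_adj_step.
by apply: spine_adj_step => //; apply/UUV/spine_U.
Qed.

(** All trees are read at offset 0, which loses nothing since [teval_ext] allows labellings to be
    shifted. *)
Inductive tree_span n : A -> Prop :=
| tree_span0 : tree_span n 0
| tree_span_cons (k : K) t rho x :
    (nbig t < n)%N -> tree_span n x -> tree_span n (k *: teval t rho 0 + x).

Lemma tree_span_eq n x y : x = y -> tree_span n x -> tree_span n y.
Proof. by move->. Qed.

Lemma tree_spanD n x y : tree_span n x -> tree_span n y -> tree_span n (x + y).
Proof.
by move=> Gx Gy; elim: Gx => [|k t rho x' nt _ IH]; rewrite ?add0r // -addrA; constructor.
Qed.

Lemma tree_spanZ n (k : K) x : tree_span n x -> tree_span n (k *: x).
Proof.
elim=> [|l t rho x' nt _ IH]; first by rewrite scaler0; constructor.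
by rewrite scalerDr scalerA; constructor.
Qed.

Lemma tree_spanN n x : tree_span n x -> tree_span n (- x).
Proof. by rewrite -scaleN1r; apply: tree_spanZ. Qed.

Lemma tree_span_le n n' x : (n <= n')%N -> tree_span n x -> tree_span n' x.
Proof.
move=> le_n; elim=> [|l t rho x' nt _ IH]; constructor => //.
exact: leq_trans le_n.
Qed.

Lemma tree_span_teval n t rho o : (nbig t < n)%N -> tree_span n (teval t rho o).
Proof.
move=> nt; rewrite -[teval _ _ _]scale1r -[_ *: _]addr0.
rewrite (teval_ext (rho' := fun i => rho (o + i)%N) (o' := 0)) //.
by constructor => //; constructor.
Qed.

Lemma tree_span_lin_ind n (P : A -> Prop) :
  P 0 -> (forall x y, P x -> P y -> P (x + y)) ->
  (forall (k : K) x, P x -> P (k *: x)) ->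
  (forall t rho, (nbig t < n)%N -> P (teval t rho 0)) -> forall x, tree_span n x -> P x.
Proof.
by move=> P0 PD PZ Pt x; elim=> // k t rho y nt _ Py; apply/PD => //; apply/PZ/Pt.
Qed.

Lemma tree_span_U n x : tree_span n x -> U x.
Proof. by apply: tree_span_lin_ind => // t rho _; apply: teval_U. Qed.

Lemma tree_span_App n x i : tree_span n x -> tree_span n (x ** W i).
Proof.
move: x; apply: tree_span_lin_ind => [|x y|k x|t rho nt].
- by rewrite linear0l; constructor.
- by rewrite linearDl; apply: tree_spanD.
- by rewrite linearZl_LR; apply: tree_spanZ.
- by rewrite -teval_App; apply: tree_span_teval.
Qed.

Lemma tree_span_Big n1 n2 x y i :
  tree_span n1 x -> tree_span n2 y -> tree_span (n1 + n2) (x ** (u i ** y)).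
Proof.
move=> Gx Gy; move: x Gx; apply: tree_span_lin_ind => [|x x'|k x|z rho1 nz].
- by rewrite linear0l; constructor.
- by rewrite linearDl; apply: tree_spanD.
- by rewrite linearZl_LR; apply: tree_spanZ.
move: y Gy; apply: tree_span_lin_ind => [|x x'|k x|y rho2 ny].
- by rewrite !linear0r; constructor.
- by rewrite !linearDr; apply: tree_spanD.
- by rewrite !linearZr_LR; apply: tree_spanZ.
(* The labelling of the new tree is [rho1], then the label [i], then [rho2]. *)
pose rho j := if (j < nlabels z)%N then rho1 j else
  if j == nlabels z then i else rho2 (j - (nlabels z).+1)%N.
suff -> : teval z rho1 0 ** (u i ** teval y rho2 0) = teval (Big z y) rho 0.
  by apply: tree_span_teval; rewrite /= -addSn -addnS leq_add.
rewrite teval_Big add0n; congr (_ ** (_ ** _)).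
- by apply: teval_ext => j jz; rewrite /rho add0n jz.
- by rewrite /rho ltnn eqxx.
apply: teval_ext => j jy; rewrite /rho addSn ltnNge ltnW ?ltnS ?leq_addr //=.
by rewrite gtn_eqF ?ltnS ?leq_addr // subSS addKn.
Qed.

Lemma tree_span_Big_tree n x i t rho o :
  tree_span n x -> tree_span (n + nbig t).+1 (x ** (u i ** teval t rho o)).
Proof. by move=> Gx; rewrite -addnS; apply: tree_span_Big => //; apply: tree_span_teval. Qed.

Lemma tree_span_tree_Big n y i t rho o :
  tree_span n y -> tree_span (nbig t + n).+1 (teval t rho o ** (u i ** y)).
Proof. by move=> Gy; rewrite -addSn; apply: tree_span_Big => //; apply: tree_span_teval. Qed.

Lemma tree_span_spine n t rho o x : tree_span n x -> tree_span (n + nbig t) (spine t rho o x).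
Proof.
elim: t n rho o x => /= [|t IH i|z IHz y _] n rho o x Gx; rewrite ?addn0 //.
  exact/tree_span_App/IH.
by rewrite addnS addnA; apply/tree_span_Big_tree/IHz.
Qed.

(** * Skew symmetry in the labels *)

Definition swap (a b i : nat) := if i == a then b else if i == b then a else i.

Lemma swapC a b : swap a b = swap b a.
Proof.
apply/funext => i; rewrite /swap; have [->|_] := eqVneq i a; last by [].
by have [->|] := eqVneq a b.
Qed.

Lemma swapl a b : swap a b a = b.
Proof. by rewrite /swap eqxx. Qed.

Lemma swapr a b : swap a b b = a.
Proof. by rewrite swapC swapl. Qed.

Lemma swap_out a b i : i != a -> i != b -> swap a b i = i.
Proof. by rewrite /swap => /negbTE-> /negbTE->. Qed.

Lemma swap_conj (a b c : nat) : a != b -> b != c -> a != c ->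
  swap a b \o swap b c \o swap a b = swap a c.
Proof.
move=> ab bc ac; apply/funext => i; rewrite /swap /=.
have [_|ia] := eqVneq i a; first by rewrite eqxx (eq_sym c) (negbTE ac) (eq_sym c) (negbTE bc).
have [->|ib] := eqVneq i b.
  by rewrite (negbTE ab) (negbTE ac) eqxx (negbTE bc).
have [->|ic] := eqVneq i c; first by rewrite (eq_sym c) (negbTE bc) eqxx (eq_sym b) (negbTE ab).
by rewrite !(negbTE ib, negbTE ia).
Qed.

(** [tree_span (nbig t)] only admits trees with strictly fewer nodes [Big] than [t], so this is
    antisymmetry modulo simpler trees. *)
Definition skew t o a b := forall rho,
  tree_span (nbig t) (teval t rho o + teval t (rho \o swap a b) o).

Lemma skewC t o a b : skew t o a b -> skew t o b a.
Proof. by move=> sk rho; rewrite swapC. Qed.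

(** Since (a c) = (a b)(b c)(a b), three sign changes make one. *)
Lemma skew_trans t o a b c : a != b -> b != c -> a != c ->
  skew t o a b -> skew t o b c -> skew t o a c.
Proof.
move=> ab bc ac sab sbc rho; rewrite -(swap_conj ab bc ac).
change (tree_span (nbig t) (teval t rho o + teval t (rho \o swap a b \o swap b c \o swap a b) o)).
have := tree_spanD (tree_spanD (sab rho) (tree_spanN (sbc (rho \o swap a b))))
  (sab (rho \o swap a b \o swap b c)).
by apply: tree_span_eq; lmodule_eq K (A : Type) ltac:(ring).
Qed.

Lemma tree_span_half n x : tree_span n (x + x) -> tree_span n x.
Proof.
move=> /(tree_spanZ 2%:R^-1); apply: tree_span_eq.
by lmodule_eq K (A : Type) ltac:(field; exact: two_neq0).
Qed.

Section BigSkew.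
Variables (z y : tree) (o : nat).
Let k := (o + nlabels z)%N.
Let T := Big z y.

Let ltok : (o < k)%N. Proof. by rewrite /k nlabelsE addnS ltnS leq_addr. Qed.
Let neq_ok : o != k. Proof. by rewrite ltn_eqF. Qed.
Let neq_ok1 : o != k.+1. Proof. by rewrite ltn_eqF // ltnW // ltnS. Qed.
Let neq_kk1 : k != k.+1. Proof. by rewrite ltn_eqF. Qed.

(** Pulled inside the spine of [z], the two labels occur as a(bY) + b(aY), which the Jacobi identity
    turns into -Y(ab). As ab is some [W w], the node [Big] becomes an [App]. *)
Lemma skew_head_mid : skew T o o k.
Proof.
move=> rho; pose Y := teval y rho k.+1.
have UY : U Y by apply: teval_U.
have -> : teval T rho o =
    (-1 : K) ^+ tsgn z *: spine z rho o (u (rho o) ** (u (rho k) ** Y)).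
  by rewrite teval_Big -spine_mulV //; apply: UUV.
have -> : teval T (rho \o swap o k) o =
    (-1 : K) ^+ tsgn z *: spine z rho o (u (rho k) ** (u (rho o) ** Y)).
  rewrite teval_Big /teval (spine_ext (rho' := rho) (o' := o)); last first.
    move=> i /andP[i0 iz] /=; rewrite swap_out //.
      by rewrite gtn_eqF // -[X in (X < _)%N]addn0 ltn_add2l.
    by rewrite ltn_eqF // ltn_add2l.
  rewrite -/(teval y (rho \o swap o k) (o + nlabels z).+1) -/k.
  have -> : teval y (rho \o swap o k) k.+1 = Y.
    apply: teval_ext => i iy /=; rewrite swap_out //.
      by rewrite gtn_eqF // (leq_trans ltok) // addSn ltnW // ltnS leq_addr.
    by rewrite gtn_eqF // addSn ltnS leq_addr.
  by rewrite /= /swap eqxx (eq_sym k) (negbTE neq_ok) eqxx -spine_mulV //; apply: UUV.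
rewrite -scalerDr -spineD; apply: tree_spanZ.
have [w wE] := Wuu (rho o) (rho k).
rewrite UUU_jacobi // -wE.
have -> : nbig T = ((nbig y).+1 + nbig z)%N by rewrite /= addSn addnC.
apply: tree_span_spine.
suff -> : - (u (rho k) ** (u (rho o) ** Y)) - Y ** W w +
    u (rho k) ** (u (rho o) ** Y) = - (Y ** W w).
  by apply/tree_spanN/tree_span_App/tree_span_teval.
by lmodule_eq K (A : Type) ltac:(ring).
Qed.

(** Adjointness of the spine of [y] exchanges the label at [k] with the head label of [y], exactly
    and not only modulo smaller trees. *)
Lemma swap_mid_right rho :
  teval T rho o = (-1 : K) ^+ teps y *: teval T (rho \o swap k k.+1) o.
Proof.
have -> : teval T (rho \o swap k k.+1) o =
    teval z rho o ** (u (rho k.+1) ** spine y rho k.+1 (u (rho k))).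
  rewrite teval_Big -/k; congr (_ ** (_ ** _)).
  - apply: teval_ext => i iz /=.
    have lt_k : (o + i < k)%N by rewrite ltn_add2l.
    by rewrite swap_out // ltn_eqF // ltnW.
  - by rewrite /= swapl.
  rewrite /teval /= swapr; apply: spine_ext => i /andP[i0 iy] /=.
  rewrite swap_out // gtn_eqF ?addSn ?ltnS ?leq_addr //.
  by rewrite -[X in (X < _)%N]addn0 ltn_add2l.
rewrite -linearZr_LR; congr (_ ** _).
exact: spine_adj.
Qed.

(* Swapping o and k is skew, so if swapping k and k.+1 is symmetric then the braid
   relation (o k)(k k+1)(o k) = (k k+1)(o k)(k k+1) gives both signs. *)
Lemma teval_null_of_sym : teps y = false -> forall rho, tree_span (nbig T) (teval T rho o).
Proof.
move=> epsy rho.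
have sym rho' : teval T (rho' \o swap k k.+1) o = teval T rho' o.
  by rewrite [RHS]swap_mid_right epsy scale1r.
have h1 := skew_head_mid rho.
have h2 := skew_head_mid (rho \o swap o k \o swap k k.+1).
have h3 := skew_head_mid (rho \o swap k k.+1).
have hl : teval T (rho \o swap o k \o swap k k.+1 \o swap o k) o =
          teval T (rho \o swap k k.+1 \o swap o k) o.
  rewrite -[RHS]sym.
  change (teval T (rho \o (swap o k \o swap k k.+1 \o swap o k)) o =
          teval T (rho \o (swap k k.+1 \o swap o k \o swap k k.+1)) o).
  rewrite swap_conj // (swapC k k.+1) (swapC o k) swap_conj 1?eq_sym //.
  by rewrite swapC.
rewrite hl !sym in h2 h3.
apply: tree_span_half; have := tree_spanD (tree_spanD h1 (tree_spanN h2)) h3.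
by apply: tree_span_eq; lmodule_eq K (A : Type) ltac:(ring).
Qed.

Lemma skew_mid_right : teps y -> skew T o k k.+1.
Proof.
move=> epsy rho; rewrite swap_mid_right epsy expr1 scaleN1r addNr.
exact: tree_span0.
Qed.

Lemma skew_left a b : (a < k)%N -> (b < k)%N -> skew z o a b -> skew T o a b.
Proof.
move=> ak bk sk rho; rewrite !teval_Big -/k /= swap_out ?gtn_eqF //.
have -> : teval y (rho \o swap a b) k.+1 = teval y rho k.+1.
  apply: teval_ext => i _ /=; rewrite addSn swap_out // gtn_eqF //.
    by rewrite ltnS ltnW // ltn_addr.
  by rewrite ltnS ltnW // ltn_addr.
by rewrite -linearDl; apply: tree_span_Big_tree.
Qed.

Lemma skew_right a b : (k < a)%N -> (k < b)%N -> skew y k.+1 a b -> skew T o a b.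
Proof.
move=> ka kb sk rho; rewrite !teval_Big -/k /= swap_out ?ltn_eqF //.
have -> : teval z (rho \o swap a b) o = teval z rho o.
  apply: teval_ext => i iz /=; have lt_k : (o + i < k)%N by rewrite ltn_add2l.
  by rewrite swap_out // ltn_eqF // (ltn_trans lt_k).
by rewrite -linearDr -linearDr; apply: tree_span_tree_Big.
Qed.

(** If [teps y] is false, the tree itself reduces to smaller ones. Otherwise each position is skew
    with the head [o], directly inside [z] and through [k] and [k.+1] inside [y]; [skew_trans] at
    [o] then gives any pair. *)
Lemma skew_Big :
  (forall o a b, (o <= a < o + nlabels z)%N -> (o <= b < o + nlabels z)%N ->
     a != b -> skew z o a b) ->
  (forall o a b, (o <= a < o + nlabels y)%N -> (o <= b < o + nlabels y)%N ->
     a != b -> skew y o a b) ->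
  forall a b, (o <= a < o + nlabels T)%N -> (o <= b < o + nlabels T)%N ->
    a != b -> skew T o a b.
Proof.
move=> IHz IHy; case epsy: (teps y); last first.
  by move=> a b _ _ _ rho; apply: tree_spanD; apply: teval_null_of_sym.
have head a : (o < a < o + nlabels T)%N -> skew T o o a.
  case/andP=> oa; rewrite /= addnA addnS -/k ltnS => ay.
  have neq_oa : o != a by rewrite ltn_eqF.
  case: (ltngtP a k) => [ak|ka|->]; last exact: skew_head_mid.
    have oz : (o <= o < o + nlabels z)%N by rewrite leqnn.
    have az : (o <= a < o + nlabels z)%N by rewrite ltnW.
    exact: (skew_left ltok ak (IHz _ _ _ oz az neq_oa)).
  have sl : skew T o o k.+1.
    exact: (skew_trans neq_ok neq_kk1 neq_ok1 skew_head_mid (skew_mid_right epsy)).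
  have [->//|neq_a] := eqVneq a k.+1.
  rewrite eq_sym in neq_a.
  have k1y : (k.+1 <= k.+1 < k.+1 + nlabels y)%N by rewrite leqnn nlabelsE addnS ltnS leq_addr.
  have a1y : (k.+1 <= a < k.+1 + nlabels y)%N by rewrite ka addSn ltnS.
  have sk := skew_right (ltnSn k) ka (IHy _ _ _ k1y a1y neq_a).
  exact: (skew_trans neq_ok1 neq_a neq_oa sl sk).
move=> a b /andP[oa aT] /andP[ob bT] ab.
have [ao|neq_ao] := eqVneq a o.
  by rewrite ao; apply: head; rewrite bT andbT ltn_neqAle ob -ao ab.
have [bo|neq_bo] := eqVneq b o.
  by rewrite bo; apply: skewC; apply: head; rewrite aT andbT ltn_neqAle oa eq_sym neq_ao.
have sa : skew T o o a.
  by apply: head; rewrite aT andbT ltn_neqAle oa eq_sym neq_ao.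
have sb : skew T o o b.
  by apply: head; rewrite bT andbT ltn_neqAle ob eq_sym neq_bo.
rewrite eq_sym in neq_bo.
exact: (skew_trans neq_ao neq_bo ab (skewC sa) sb).
Qed.

End BigSkew.

Lemma skew_all t o a b : (o <= a < o + nlabels t)%N -> (o <= b < o + nlabels t)%N ->
  a != b -> skew t o a b.
Proof.
elim: t o a b => [|t IH i|z IHz y IHy] o a b.
- by rewrite addn1 !ltnS -!eqn_leq => /eqP<- /eqP<-; rewrite eqxx.
- move=> /= ha hb ab rho; rewrite !teval_App -linearDl.
  exact/tree_span_App/IH.
- exact: skew_Big.
Qed.

(** A tree with at least [m] nodes [Big] has more than [m] labels, so two coincide; swapping them
    fixes the tree, while skewness negates it modulo smaller trees. *)
Lemma teval_collapse t rho : (m <= nbig t)%N -> tree_span (nbig t) (teval t rho 0).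
Proof.
move=> le_mt; have [i [j [ij eq_rho]]] : exists i j : 'I_(nlabels t), i != j /\ rho i = rho j.
  have : ~~ injectiveb (fun i : 'I_(nlabels t) => rho i).
    apply/negP => /injectiveP/leq_card; rewrite !card_ord leqNgt nlabelsE ltnS.
    by rewrite (leq_trans le_mt) // -addnn leq_addr.
  case/injectivePn => i [j ij eq_rho]; by exists i, j.
have := @skew_all t 0 i j; rewrite !add0n /= !ltn_ord => /(_ isT isT ij rho) sk.
apply: tree_span_half; move: sk; apply: tree_span_eq; congr (_ + _).
apply: teval_ext => l _; rewrite /= /swap add0n.
by case: eqVneq => [->|_] //; case: eqVneq => [->|_].
Qed.

(** Repeated collapse lowers any bound [n] to [m]; this makes [tree_span m] closed under the
    operation of [Big]. *)
Lemma tree_span_bounded n x : tree_span n x -> tree_span m x.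
Proof.
elim: n x => [|n IH] x; first exact: tree_span_le.
have [lt_nm|le_mn] := ltnP n m; first exact: tree_span_le.
move=> Gx; apply: IH; move: x Gx; apply: tree_span_lin_ind => [||k x|t rho].
- exact: tree_span0.
- exact: tree_spanD.
- exact: tree_spanZ.
rewrite ltnS leq_eqVlt => /predU1P[tn|]; last exact: tree_span_teval.
by rewrite -tn; apply: teval_collapse; rewrite tn.
Qed.

(** * Finite spanning families of trees *)

Definition Wclosure (l : seq I) (s : seq A) : seq A :=
  foldr (fun i s' => s' ++ [seq x ** W i | x <- s']) s l.

Lemma Wclosure_sub l s x : x \in s -> x \in Wclosure l s.
Proof. by elim: l => //= i l IH xs; rewrite mem_cat IH. Qed.

Lemma Wclosure_U l s : (forall x, x \in s -> U x) ->
  forall x, x \in Wclosure l s -> U x.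
Proof.
move=> sU; elim: l => //= i l IH x; rewrite mem_cat => /orP[/IH//|].
by case/mapP => y /IH Uy ->; apply: UVU.
Qed.

Lemma inspan_mulr s s' v : (forall x, x \in s -> inspan s' (x ** v)) ->
  forall x, inspan s x -> inspan s' (x ** v).
Proof.
move=> sv; apply: inspan_min => // [|x y|k x].
- by rewrite linear0l; apply: inspan0.
- by rewrite linearDl; apply: inspanD.
- by rewrite linearZl_LR; apply: inspanZ.
Qed.

(** [W i] anticommutes past the outermost operator [W j], and applying [W j] twice gives 0; so it is
    enough to use each entry of [l] at most once, in a fixed order. *)
Lemma WclosureP l s i x : (forall x, x \in s -> U x) -> i \in l ->
  inspan (Wclosure l s) x -> inspan (Wclosure l s) (x ** W i).
Proof.
move=> sU; elim: l i x => //= j l IH i x; rewrite inE => il; move: x.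
set s1 := Wclosure l s; set s2 := [seq _ | _ <- _].
have s12 y : inspan s1 y -> inspan (s1 ++ s2) y.
  by apply: inspan_sub => z zs; apply: inspan_mem; rewrite mem_cat zs.
have s1j y : inspan s1 y -> inspan (s1 ++ s2) (y ** W j).
  apply: inspan_mulr => z zs; apply: inspan_mem.
  by rewrite mem_cat (map_f (fun z => z ** W j)) // orbT.
apply: inspan_mulr => x; rewrite mem_cat => /orP[xs|/mapP[y ys ->]].
  case/predU1P: il => [->|il]; first exact/s1j/inspan_mem.
  exact/s12/IH/inspan_mem.
have Uy : U y by apply: Wclosure_U ys.
rewrite UVV_skew //; case/predU1P: il => [->|il]; last first.
  exact/inspanN/s1j/IH/inspan_mem.
suff -> : y ** W j ** W j = 0 by rewrite oppr0; apply: inspan0.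
have /eqP := UVV_skew Uy (VW j) (VW j).
by rewrite -addr_eq0 -mulr2n -scaler_nat scaler_eq0 (negbTE two_neq0) => /eqP.
Qed.

(** Below its outer operators [W i], a tree is a leaf or a node [Big] whose two subtrees satisfy the
    smaller bound. The resulting products form the finite list [b], which [Wclosure] completes. *)
Lemma tree_span_finite n : exists2 s, (forall x, x \in s -> U x) &
  forall x, tree_span n x -> inspan s x.
Proof.
elim: n => [|n [s sU sP]].
  by exists [::] => //; apply: tree_span_lin_ind => [|x y|k x|//];
    [exact: inspan0 | exact: inspanD | exact: inspanZ].
pose b := codom u ++
  [seq x ** p | x <- s, p <- [seq u k ** y | k <- enum 'I_m, y <- s]].
have bU x : x \in b -> U x.
  rewrite mem_cat => /orP[/codomP[k ->]//|/allpairsP[[y p] /= [ys + ->]]].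
  by case/allpairsP => [[k z] /= [_ zs ->]]; apply: UVU; [exact: sU | apply: UUV => //; exact: sU].
exists (Wclosure (enum I) b); first exact: Wclosure_U.
apply: tree_span_lin_ind => [|x y|k x|t rho]; [exact: inspan0|exact: inspanD|exact: inspanZ|].
have sub x : inspan b x -> inspan (Wclosure (enum I) b) x.
  by apply: inspan_sub => y yb; apply/inspan_mem/Wclosure_sub.
elim: t => /= [|t IH i|z _ y _] nt.
- by apply/sub/inspan_mem; rewrite mem_cat codom_f.
- by rewrite teval_App; apply: WclosureP; rewrite ?mem_enum //; apply: IH.
rewrite teval_Big; apply: sub; rewrite ltnS in nt.
have := sP _ (tree_span_teval rho 0 (leq_ltn_trans (leq_addr _ _) nt)).
apply: inspan_mulr => x xs; set k := rho _.
have := sP _ (tree_span_teval rho (0 + nlabels z).+1 (leq_ltn_trans (leq_addl _ _) nt)).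
move: (teval y _ _); apply: inspan_min => [|||p ps].
- by rewrite !linear0r; apply: inspan0.
- by move=> p q; rewrite !linearDr; apply: inspanD.
- by move=> c p; rewrite !linearZr_LR; apply: inspanZ.
apply: inspan_mem; rewrite mem_cat allpairs_f ?orbT //.
by apply: allpairs_f; rewrite ?mem_enum.
Qed.

(** * A finite-dimensional subalgebra containing the generators *)

Variable e : A.
Hypotheses (eU : forall a, U a -> e ** a = 2%:R^-1 *: a)
  (V0 : V 0) (VD : forall x y, V x -> V y -> V (x + y))
  (VZ : forall (k : K) x, V x -> V (k *: x))
  (ee : e ** e = e) (eV : forall v, V v -> e ** v = 0)
  (VV0 : forall v v', V v -> V v' -> v ** v' = 0).

Inductive Vgen : A -> Prop :=
| Vgen_zero : Vgen 0
| Vgen_W (k : K) i x : Vgen x -> Vgen (k *: W i + x)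
| Vgen_UG i g x : tree_span m g -> Vgen x -> Vgen (u i ** g + x).

Lemma Vgen_add x y : Vgen x -> Vgen y -> Vgen (x + y).
Proof.
by move=> Vx Vy; elim: Vx => [|k i z _ IH|i g z Gg _ IH];
  rewrite ?add0r // -addrA; constructor.
Qed.

Lemma Vgen_scale (k : K) x : Vgen x -> Vgen (k *: x).
Proof.
elim=> [|l i z _ IH|i g z Gg _ IH]; first by rewrite scaler0; constructor.
  by rewrite scalerDr scalerA; constructor.
by rewrite scalerDr -linearZr_LR; constructor => //; apply: tree_spanZ.
Qed.

Lemma Vgen_V x : Vgen x -> V x.
Proof.
elim=> [//|k i z _ Vz|i g z Gg _ Vz]; apply: VD => //; first exact: VZ.
by apply: UUV => //; apply: tree_span_U Gg.
Qed.

Lemma tree_span_mulr_Vgen x v : tree_span m x -> Vgen v -> tree_span m (x ** v).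
Proof.
move=> Gx; elim=> [|k i z _ IH|i g z Gg _ IH].
- by rewrite linear0r; apply: tree_span0.
- rewrite linearDr linearZr_LR; apply: tree_spanD => //.
  exact/tree_spanZ/tree_span_App.
- rewrite linearDr; apply: tree_spanD => //.
  exact: tree_span_bounded (tree_span_Big _ Gx Gg).
Qed.

(** Adjointness moves the spine of one tree onto the other factor, leaving the product of a single
    generator with an element of the tree span, the shape allowed by [Vgen_UG]. *)
Lemma tree_span_mul_Vgen x y : tree_span m x -> tree_span m y -> Vgen (x ** y).
Proof.
move=> Gx Gy; move: x Gx; apply: tree_span_lin_ind => [|x x'|k x|t rho _].
- by rewrite linear0l; apply: Vgen_zero.
- by rewrite linearDl; apply: Vgen_add.
- by rewrite linearZl_LR; apply: Vgen_scale.
rewrite mulC spine_adj //; last exact: tree_span_U Gy.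
apply: Vgen_scale; rewrite -[_ ** _]addr0; apply: Vgen_UG; last exact: Vgen_zero.
exact: tree_span_bounded (tree_span_spine _ _ _ Gy).
Qed.

Definition generated x : Prop :=
  exists (k : K) g v, [/\ tree_span m g, Vgen v & x = k *: e + g + v].

Lemma generated_add x y : generated x -> generated y -> generated (x + y).
Proof.
move=> [k [g [v [Gg Vv ->]]]] [k' [g' [v' [Gg' Vv' ->]]]].
exists (k + k'), (g + g'), (v + v'); split; [exact: tree_spanD|exact: Vgen_add|].
by lmodule_eq K (A : Type) ltac:(ring).
Qed.

Lemma generated_scale (k : K) x : generated x -> generated (k *: x).
Proof.
move=> [k' [g [v [Gg Vv ->]]]]; exists (k * k'), (k *: g), (k *: v).
split; [exact: tree_spanZ|exact: Vgen_scale|].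
by lmodule_eq K (A : Type) ltac:(ring).
Qed.

Lemma generated_e : generated e.
Proof.
exists 1, 0, 0; split; [exact: tree_span0|exact: Vgen_zero|].
by rewrite scale1r !addr0.
Qed.

Lemma generated_G g : tree_span m g -> generated g.
Proof.
by move=> Gg; exists 0, g, 0; split=> //; [exact: Vgen_zero | rewrite scale0r add0r addr0].
Qed.

Lemma generated_V v : Vgen v -> generated v.
Proof.
by move=> Vv; exists 0, 0, v; split=> //; [exact: tree_span0 | rewrite scale0r !add0r].
Qed.

Lemma generated_ind (P : A -> Prop) :
  (forall x y, P x -> P y -> P (x + y)) -> (forall (k : K) x, P x -> P (k *: x)) ->
  P e -> (forall g, tree_span m g -> P g) -> (forall v, Vgen v -> P v) ->
  forall x, generated x -> P x.
Proof.
move=> PD PZ Pe PG PV x [k [g [v [Gg Vv ->]]]].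
exact: (PD _ _ (PD _ _ (PZ _ _ Pe) (PG _ Gg)) (PV _ Vv)).
Qed.

Lemma generated_subalgebra : is_subalgebra generated.
Proof.
split; [exact/generated_G/tree_span0|exact: generated_add|exact: generated_scale|].
have eP : forall x, generated x -> generated (e ** x).
  apply: generated_ind => [x y|k x||g Gg|v Vv].
  - by rewrite linearDr; apply: generated_add.
  - by rewrite linearZr_LR; apply: generated_scale.
  - by rewrite ee; apply: generated_e.
  - rewrite eU; last exact: tree_span_U Gg.
    exact/generated_scale/generated_G.
  - by rewrite eV; [exact/generated_G/tree_span0 | exact: Vgen_V].
have GP g : tree_span m g -> forall x, generated x -> generated (g ** x).
  move=> Gg; apply: generated_ind => [x y|k x||g' Gg'|v Vv].
  - by rewrite linearDr; apply: generated_add.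
  - by rewrite linearZr_LR; apply: generated_scale.
  - by rewrite mulC; apply/eP/generated_G.
  - exact/generated_V/tree_span_mul_Vgen.
  - exact/generated_G/tree_span_mulr_Vgen.
have VP v : Vgen v -> forall x, generated x -> generated (v ** x).
  move=> Vv; apply: generated_ind => [x y|k x||g Gg|v' Vv'].
  - by rewrite linearDr; apply: generated_add.
  - by rewrite linearZr_LR; apply: generated_scale.
  - by rewrite mulC; apply/eP/generated_V.
  - by rewrite mulC; apply/GP/generated_V.
  - by rewrite VV0; [exact/generated_G/tree_span0 | exact: Vgen_V | exact: Vgen_V].
move=> x y Tx Ty; move: x Tx; apply: generated_ind => [x x'|k x||g Gg|v Vv].
- by rewrite linearDl; apply: generated_add.
- by rewrite linearZl_LR; apply: generated_scale.
- exact: eP.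
- exact: GP.
- exact: VP.
Qed.

Lemma generated_span : exists s, forall x, generated x -> inspan s x.
Proof.
have [s _ sP] := tree_span_finite m.
pose s' := e :: s ++ codom W ++ [seq u i ** g | i <- enum 'I_m, g <- s].
have sub x : inspan s x -> inspan s' x.
  by apply: inspan_sub => y ys; apply: inspan_mem; rewrite inE mem_cat ys orbT.
exists s'; apply: generated_ind => [x y|k x||g Gg|v].
- exact: inspanD.
- exact: inspanZ.
- by apply: inspan_mem; rewrite mem_head.
- exact/sub/sP.
elim=> [|k i z _ IH|i g z Gg _ IH]; first exact: inspan0.
  apply: inspanD => //; apply/inspanZ/inspan_mem.
  by rewrite !(inE, mem_cat) codom_f !orbT.
apply: inspanD => //; rewrite mulC; move: g {Gg} (sP _ Gg).
apply: inspan_mulr => g gs; apply: inspan_mem; rewrite mulC !(inE, mem_cat).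
by rewrite (allpairs_f (fun i g => u i ** g)) ?orbT ?mem_enum.
Qed.

Lemma generators_u_W (k : K) i j : generated (k *: e + u i + W j).
Proof.
exists k, (u i), (W j); split=> //.
  by apply: (@tree_span_bounded 1); apply: (@tree_span_teval 1 Leaf (fun=> i) 0).
by rewrite -[W j]scale1r -[_ *: _]addr0; apply: Vgen_W; apply: Vgen_zero.
Qed.

End AlternatingTrees.

(** * Peirce decomposition *)

Section Peirce.
Variables (K : fieldType) (A : nalg K) (w : {scalar A}).
Local Notation "x ** y" := (amul A x y) (at level 40, left associativity).
Hypotheses (two_neq0 : 2%:R != 0 :> K) (three_neq0 : 3%:R != 0 :> K).
Hypothesis bern : is_bernstein w.

Let mulC : is_commutative A. Proof. by case: bern. Qed.

(** The denominators 4, 12 and 24 of the Peirce identities and of the interpolation are invertible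
    outside characteristics 2 and 3. *)
Let four_neq0 : 4%:R != 0 :> K.
Proof. by rewrite (natrM _ 2 2) mulf_neq0. Qed.

Let twelve_neq0 : 12%:R != 0 :> K.
Proof. by rewrite (natrM _ 4 3) mulf_neq0. Qed.

Let twentyfour_neq0 : 24%:R != 0 :> K.
Proof. by rewrite (natrM _ 2 12) mulf_neq0. Qed.

Lemma eq_of_null (x y z : A) : z = 0 -> x - y = z -> x = y.
Proof. by move=> -> /eqP; rewrite subr_eq0 => /eqP. Qed.

(* Interpolation at 1, -1, 2, -2. *)
Lemma quartic_null (c1 c2 c3 c4 : A) :
  (forall k : K, k *: c1 + k ^+ 2 *: c2 + k ^+ 3 *: c3 + k ^+ 4 *: c4 = 0) ->
  [/\ c1 = 0, c2 = 0 & c3 = 0].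
Proof.
move=> P0; pose P (k : K) := k *: c1 + k ^+ 2 *: c2 + k ^+ 3 *: c3 + k ^+ 4 *: c4.
have comb0 (k1 k2 k3 k4 : K) :
    k1 *: P 1 + k2 *: P (-1) + k3 *: P 2%:R + k4 *: P (-2%:R) = 0.
  by rewrite /P !P0 !scaler0 !addr0.
split.
- apply: (eq_of_null (comb0 (8%:R / 12%:R) (- 8%:R / 12%:R) (- 12%:R^-1) 12%:R^-1)).
  by rewrite /P; lmodule_eq K (A : Type)
    ltac:(field; rewrite ?four_neq0 ?twelve_neq0 ?twentyfour_neq0).
- apply: (eq_of_null (comb0 (16%:R / 24%:R) (16%:R / 24%:R) (- 24%:R^-1) (- 24%:R^-1))).
  by rewrite /P; lmodule_eq K (A : Type)
    ltac:(field; rewrite ?four_neq0 ?twelve_neq0 ?twentyfour_neq0).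
apply: (eq_of_null (comb0 (- 2%:R / 12%:R) (2%:R / 12%:R) 12%:R^-1 (- 12%:R^-1))).
by rewrite /P; lmodule_eq K (A : Type)
    ltac:(field; rewrite ?four_neq0 ?twelve_neq0 ?twentyfour_neq0).
Qed.

(** For w(x) nonzero, the Bernstein identity makes x^2 / w(x)^2 idempotent. *)
Lemma bernstein_idempotent : exists2 e, e ** e = e & w e = 1.
Proof.
have [_ [wM [x wx]] bern2] := bern.
exists ((w x ^- 2) *: (x ** x)); last first.
  by rewrite linearZ /= wM -expr2 mulVf // expf_eq0.
rewrite linearZl_LR linearZr_LR bern2 !scalerA; congr (_ *: _).
by rewrite -mulrA mulVf ?mulr1 // expf_eq0.
Qed.

Variable e : A.
Hypotheses (ee : e ** e = e) (we : w e = 1).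

Let wM x y : w (x ** y) = w x * w y.
Proof. by case: bern => _ [+ _] _; apply. Qed.

(** These are the coefficients of k, k^2 and k^3 in the Bernstein identity at e + k n. *)
Lemma peirce_identities n : w n = 0 ->
  [/\ e ** (e ** n) = 2%:R^-1 *: (e ** n),
      2%:R *: (e ** (n ** n)) + 4%:R *: ((e ** n) ** (e ** n)) = n ** n
    & (e ** n) ** (n ** n) = 0].
Proof.
move=> wn; have [_ _ bern2] := bern.
have [|c1 c2 c3] := @quartic_null (4%:R *: (e ** (e ** n)) - 2%:R *: (e ** n))
  (2%:R *: (e ** (n ** n)) + 4%:R *: ((e ** n) ** (e ** n)) - n ** n)
  (4%:R *: ((e ** n) ** (n ** n))) ((n ** n) ** (n ** n)).
  move=> k; have := bern2 (e + k *: n).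
  have -> : w (e + k *: n) = 1 by rewrite linearD linearZ /= wn we mulr0 addr0.
  rewrite expr1n scale1r => /eqP.
  rewrite -subr_eq0 => /eqP; apply: etrans.
  rewrite !(linearDl, linearDr, linearZl_LR, linearZr_LR) !ee.
  rewrite !(mulC n e) !(mulC (e ** n) e) !(mulC (n ** n) e) !(mulC (n ** n) (e ** n)).
  by lmodule_eq K (A : Type) ltac:(ring).
split.
- apply: (eq_of_null (z := 4%:R^-1 *: (4%:R *: (e ** (e ** n)) - 2%:R *: (e ** n)))).
    by rewrite c1 scaler0.
  by lmodule_eq K (A : Type) ltac:(field; rewrite ?four_neq0 ?two_neq0).
- exact: eq_of_null c2 _.
- apply: (eq_of_null (z := 4%:R^-1 *: (4%:R *: ((e ** n) ** (n ** n))))).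
    by rewrite c3 scaler0.
  by lmodule_eq K (A : Type) ltac:(field; rewrite ?four_neq0 ?two_neq0).
Qed.

Let U : set A := [set a | e ** a = 2%:R^-1 *: a].
Let V : set A := [set v | e ** v = 0].

Lemma U_null a : U a -> w a = 0.
Proof.
rewrite /U /= => ea; have /eqP := wM e a; rewrite ea we mul1r linearZ /= -subr_eq0.
have -> : 2%:R^-1 * w a - w a = - 2%:R^-1 * w a by field; rewrite two_neq0.
by rewrite mulf_eq0 oppr_eq0 invr_eq0 (negbTE two_neq0) => /eqP.
Qed.

Lemma V_null v : V v -> w v = 0.
Proof. by rewrite /V /= => ev; have := wM e v; rewrite ev we mul1r linear0. Qed.

Lemma U_zero : U 0. Proof. by rewrite /U /= linear0r scaler0. Qed.
Lemma V_zero : V 0. Proof. by rewrite /V /= linear0r. Qed.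

Lemma U_add x y : U x -> U y -> U (x + y).
Proof. by rewrite /U /= => ex ey; rewrite linearDr ex ey scalerDr. Qed.

Lemma V_add x y : V x -> V y -> V (x + y).
Proof. by rewrite /V /= => ex ey; rewrite linearDr ex ey addr0. Qed.

Lemma U_scale (k : K) x : U x -> U (k *: x).
Proof. by rewrite /U /= => ex; rewrite linearZr_LR ex !scalerA mulrC. Qed.

Lemma V_scale (k : K) x : V x -> V (k *: x).
Proof. by rewrite /V /= => ex; rewrite linearZr_LR ex scaler0. Qed.

Lemma peirce_decomposition x :
  exists u v, [/\ U u, V v & x = w x *: e + u + v].
Proof.
pose n := x - w x *: e.
have wn : w n = 0 by rewrite linearB linearZ /= we mulr1 subrr.
have [een _ _] := peirce_identities wn.
(* By e(en) = (1/2) en the element 2 en lies in [U], and subtracting it from [n] leaves an element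
   killed by [e]. *)
exists (2%:R *: (e ** n)), (n - 2%:R *: (e ** n)); split.
- by rewrite /U /= linearZr_LR een !scalerA mulrC.
- by rewrite /V /= linearBr linearZr_LR een scalerA mulfV // scale1r subrr.
- by rewrite /n; lmodule_eq K (A : Type) ltac:(ring).
Qed.

(** Linearization of the second identity. Since [e] acts on each factor by 1/2 or 0, it yields the
    inclusions UU in V, UV in U and VV in U. *)
Lemma peirce_polarized n n' : w n = 0 -> w n' = 0 ->
  2%:R *: (e ** (n ** n')) + 4%:R *: ((e ** n) ** (e ** n')) = n ** n'.
Proof.
move=> wn wn'; have wnn : w (n + n') = 0 by rewrite linearD wn wn' addr0.
have [_ h1 _] := peirce_identities wn; have [_ h2 _] := peirce_identities wn'.
have [_ h3 _] := peirce_identities wnn.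
move: h3; rewrite !(linearDl, linearDr) (mulC n' n) (mulC (e ** n') (e ** n)).
move=> /eqP; rewrite -subr_eq0 => /eqP h3.
move/eqP: h1; rewrite -subr_eq0 => /eqP h1; move/eqP: h2; rewrite -subr_eq0 => /eqP h2.
have := f_equal3 (fun a b c : A => 2%:R^-1 *: (a - b - c)) h3 h1 h2.
rewrite !subr0 scaler0 => h; apply: (eq_of_null h).
by lmodule_eq K (A : Type) ltac:(field; rewrite ?two_neq0).
Qed.

Lemma UU_V a b : U a -> U b -> V (a ** b).
Proof.
move=> Ua Ub; have := peirce_polarized (U_null Ua) (U_null Ub).
rewrite [e ** a]Ua [e ** b]Ub linearZl_LR linearZr_LR => /eqP.
rewrite -subr_eq0 => /eqP /(congr1 (fun z : A => 2%:R^-1 *: z)) /=.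
rewrite scaler0 => h; apply: (eq_of_null h).
by lmodule_eq K (A : Type) ltac:(field; rewrite ?two_neq0).
Qed.

Lemma UV_U a v : U a -> V v -> U (a ** v).
Proof.
move=> Ua Vv; have := peirce_polarized (U_null Ua) (V_null Vv).
rewrite [e ** v]Vv linear0r scaler0 addr0 => h.
by rewrite /U /= -[in RHS]h scalerA mulVf // scale1r.
Qed.

Lemma VV_U v v' : V v -> V v' -> U (v ** v').
Proof.
move=> Vv Vv'; have := peirce_polarized (V_null Vv) (V_null Vv').
rewrite [e ** v]Vv linear0l scaler0 addr0 => h.
by rewrite /U /= -[in RHS]h scalerA mulVf // scale1r.
Qed.

(** * Identities forced by degree at most 2 *)

Section DegreeTwo.
Hypothesis deg2 : degrees_le A 2.

(** x, x^2 and x^3 lie in a subalgebra of dimension at most 2. *)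
Lemma cubic_relation x : exists2 c : K * K * K, c != 0 &
  c.1.1 *: x + c.1.2 *: (x ** x) + c.2 *: (x ** (x ** x)) = 0.
Proof.
have [m [b [bP _]] le_m2] := deg2 x.
have [|r [j rj] r0] := @dependent_family _ _ _ 3 b
    (fun j => [:: x; x ** x; x ** (x ** x)]`_j) _ le_m2.
  move=> j; apply/bP => M [[_ _ _ MM] /(_ x erefl) Mx].
  by case: j => [[|[|[|//]]] _] /=; do ?apply: (MM).
exists (r ord0, r (inord 1), r (inord 2)).
  apply: contra_neq rj => [[r00 r1 r2]].
  case: j => [[|[|[|]]]] //= lt_j.
  - by rewrite -r00; congr r; apply: val_inj.
  - by rewrite -r1; congr r; apply: val_inj; rewrite /= inordK.
  - by rewrite -r2; congr r; apply: val_inj; rewrite /= inordK.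
have l1 : lift ord0 ord0 = inord 1 :> 'I_3 by apply: val_inj; rewrite /= inordK.
have l2 : lift ord0 (lift ord0 ord0) = inord 2 :> 'I_3.
  by apply: val_inj; rewrite /= inordK.
by move: r0; rewrite !big_ord_recl big_ord0 /= addr0 addrA l1 l2.
Qed.

Lemma peirce_direct (k : K) a v : U a -> V v -> k *: e + a + v = 0 ->
  [/\ k = 0, a = 0 & v = 0].
Proof.
move=> Ua Vv kav; have k0 : k = 0.
  have := congr1 w kav.
  by rewrite !linearD linearZ /= we (U_null Ua) (V_null Vv) mulr1 !addr0 linear0.
have := congr1 (amul A e) kav; rewrite k0 scale0r add0r linearDr linear0r.
rewrite [e ** a]Ua [e ** v]Vv addr0 => /eqP.
rewrite scaler_eq0 invr_eq0 (negbTE two_neq0) /= => /eqP a0.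
by split=> //; move: kav; rewrite k0 a0 scale0r !add0r.
Qed.

Lemma half_add (x : A) : x + x = 0 -> x = 0.
Proof.
by rewrite -mulr2n -scaler_nat => /eqP; rewrite scaler_eq0 (negbTE two_neq0) => /eqP.
Qed.

(** The cubic relation at e + v forces v v^2 = (1/2) v^2; replacing [v] by -v changes the sign of
    the left side only, so v^2 = 0. *)
Lemma V_sqr v : V v -> v ** v = 0.
Proof.
suff cub x : V x -> x ** (x ** x) = 2%:R^-1 *: (x ** x).
  move=> Vv; have h1 : - (v ** (v ** v)) = 2%:R^-1 *: (v ** v).
    have := cub (- v); rewrite !(linearNl, linearNr, opprK); apply.
    by rewrite -scaleN1r; apply: V_scale.
  have : 2%:R^-1 *: (v ** v) + 2%:R^-1 *: (v ** v) = 0.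
    by rewrite -{1}h1 -(cub _ Vv) addNr.
  by move=> h; apply: (eq_of_null h); lmodule_eq K (A : Type) ltac:(field; rewrite ?two_neq0).
move: x => {}v Vv; set s := v ** v.
have Us : U s by apply: VV_U.
have Uvs : U (v ** s) by rewrite mulC; apply: UV_U.
have [[[a b] c] /= abc rel] := cubic_relation (e + v).
(* For nonzero [v], the [V]-component gives a = 0, the weight then gives b = -c with c nonzero, and
   the [U]-component becomes the claim. *)
have [|||k0 s0 v0] := @peirce_direct (a + b + c) (b *: s + c *: (2%:R^-1 *: s + v ** s)) (a *: v).
- by apply: U_add; apply: U_scale => //; apply: U_add => //; apply: U_scale.
- exact: V_scale.
- rewrite -[RHS]rel !(linearDl, linearDr) !ee !(mulC v e) [e ** v]Vv !linear0r.
  by rewrite -/s [e ** s]Us; lmodule_eq K (A : Type) ltac:(ring).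
have [v_eq0|v_neq0] := eqVneq v 0; first by rewrite /s v_eq0 !linear0l scaler0.
move/eqP: v0; rewrite scaler_eq0 (negbTE v_neq0) orbF => /eqP a0.
have bE : b = - c by apply/eqP; rewrite -addr_eq0 -[b + c]add0r -{1}a0 addrA k0.
have c_neq0 : c != 0.
  by apply: contra_neq abc => c0; rewrite a0 bE c0 oppr0.
have := congr1 (fun z : A => c^-1 *: z) s0; rewrite bE scaler0 => h.
apply: (eq_of_null h).
by lmodule_eq K (A : Type) ltac:(field; rewrite ?two_neq0 ?c_neq0).
Qed.

Lemma VV_zero v v' : V v -> V v' -> v ** v' = 0.
Proof.
move=> Vv Vv'; have := V_sqr (V_add Vv Vv').
rewrite !(linearDl, linearDr) !V_sqr // add0r addr0 (mulC v') => h.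
exact: half_add.
Qed.

(** For n = a + v, where v^2 = 0, the identity (en) n^2 = 0 has, up to the factor 1/2, the
    [U]-component a a^2 and the [V]-component 2 a(av). *)
Lemma U_cube_UUV a v : U a -> V v -> a ** (a ** a) = 0 /\ a ** (a ** v) = 0.
Proof.
move=> Ua Vv.
have wav : w (a + v) = 0 by rewrite linearD (U_null Ua) (V_null Vv) addr0.
have [_ _ h] := peirce_identities wav.
have [|||_ h1 h2] := @peirce_direct 0 (a ** (a ** a)) (2%:R *: (a ** (a ** v))).
- by apply: UV_U => //; apply: UU_V.
- by apply/V_scale/UU_V => //; apply: UV_U.
- have := congr1 (fun z : A => 2%:R *: z) h; rewrite scaler0 => h'.
  apply: (eq_of_null h').
  rewrite !(linearDl, linearDr) [e ** v]Vv [e ** a]Ua (V_sqr Vv).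
  rewrite !(linearDl, linearDr, linear0l, linear0r, linearZl_LR) (mulC v a).
  by lmodule_eq K (A : Type) ltac:(field; rewrite ?two_neq0).
split=> //; move/eqP: h2.
by rewrite scaler_eq0 (negbTE two_neq0) => /eqP.
Qed.

Lemma UVV_zero a v : U a -> V v -> (a ** v) ** v = 0.
Proof.
move=> Ua Vv; have [a3 aav] := U_cube_UUV Ua Vv.
have Uav := UV_U Ua Vv; have Uavv := UV_U Uav Vv; have Vaa := UU_V Ua Ua.
have [[[c1 c2] c3] /= c_neq0 rel] := cubic_relation (e + a + v).
have [|||k0 u0 v0] := @peirce_direct (c1 + c2 + c3)
   ((c1 + c2 + c3) *: a + (2%:R * (c2 + c3)) *: (a ** v) + (2%:R * c3) *: ((a ** v) ** v))
   (c1 *: v + (c2 + c3) *: (a ** a)).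
- by apply: U_add; [apply: U_add|]; apply: U_scale.
- by apply: V_add; apply: V_scale.
- rewrite -[RHS]rel.
  have -> : (e + a + v) ** (e + a + v) = e + a + a ** a + 2%:R *: (a ** v).
    rewrite !(linearDl, linearDr) ee (mulC a e) (mulC v e) (mulC v a).
    rewrite [e ** a]Ua [e ** v]Vv (V_sqr Vv).
    by lmodule_eq K (A : Type) ltac:(field; rewrite ?two_neq0).
  rewrite !(linearDl, linearDr, linearZr_LR) ee (mulC a e) (mulC v e) (mulC v a).
  rewrite [e ** a]Ua [e ** v]Vv [e ** (a ** a)]Vaa [e ** (a ** v)]Uav.
  rewrite a3 aav (VV_zero Vv Vaa) (mulC v (a ** v)).
  by lmodule_eq K (A : Type) ltac:(field; rewrite ?two_neq0).
rewrite k0 scale0r add0r in u0.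
have c23 : c2 + c3 = - c1 by apply/eqP; rewrite -addr_eq0 addrC addrA k0.
(* If c1 = 0, the [U]-component reduces to 2 c3 (av)v with c3 nonzero; otherwise the [V]-component
   gives v = a^2, and av = a a^2 = 0. *)
have [c1_eq0|c1_neq0] := eqVneq c1 0.
  have c3_neq0 : c3 != 0.
    apply: contra_neq c_neq0 => c3_eq0; move: c23.
    by rewrite c1_eq0 c3_eq0 addr0 oppr0 => ->.
  move/eqP: u0; rewrite c23 c1_eq0 oppr0 mulr0 scale0r add0r scaler_eq0.
  by rewrite mulf_eq0 (negbTE two_neq0) (negbTE c3_neq0) => /eqP.
have -> : v = a ** a.
  have := congr1 (fun z : A => c1^-1 *: z) v0; rewrite c23 scaler0 => h.
  by apply: (eq_of_null h); lmodule_eq K (A : Type) ltac:(field; rewrite ?c1_neq0).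
by rewrite a3 linear0l.
Qed.

Lemma UVV_skew a v v' : U a -> V v -> V v' -> (a ** v) ** v' = - ((a ** v') ** v).
Proof.
move=> Ua Vv Vv'; apply/eqP; rewrite -addr_eq0; apply/eqP.
have := UVV_zero Ua (V_add Vv Vv').
by rewrite !(linearDl, linearDr) !UVV_zero // add0r addr0 addrC.
Qed.

Lemma UUV_skew a b v : U a -> U b -> V v -> a ** (b ** v) = - (b ** (a ** v)).
Proof.
move=> Ua Ub Vv; apply/eqP; rewrite -addr_eq0; apply/eqP.
have [_] := U_cube_UUV (U_add Ua Ub) Vv.
have [_ h1] := U_cube_UUV Ua Vv; have [_ h2] := U_cube_UUV Ub Vv.
by rewrite !(linearDl, linearDr) h1 h2 add0r addr0 addrC.
Qed.

Lemma UUU_jacobi a b c : U a -> U b -> U c ->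
  a ** (b ** c) = - (b ** (a ** c)) - c ** (a ** b).
Proof.
have cube x : U x -> x ** (x ** x) = 0 by move=> Ux; case: (U_cube_UUV Ux V_zero).
(* The part linear in [y] of the cube identity, isolated by evaluating at x + y, x - y and y. *)
have cube2 x y : U x -> U y -> y ** (x ** x) + 2%:R *: (x ** (x ** y)) = 0.
  move=> Ux Uy; have h1 := cube _ (U_add Ux Uy).
  have h2 := cube _ (U_add Ux (U_scale (-1) Uy)).
  have h3 := cube _ Uy.
  have := f_equal3 (fun p q r : A => 2%:R^-1 *: (p - q - 2%:R *: r)) h1 h2 h3.
  rewrite !(scaler0, subr0) => h; apply: (eq_of_null h).
  rewrite !(linearDl, linearDr, linearZl_LR, linearZr_LR) (mulC y x).
  rewrite /=; by lmodule_eq K (A : Type) ltac:(field; rewrite ?two_neq0).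
move=> Ua Ub Uc.
have h1 := cube2 _ _ (U_add Ua Ub) Uc; have h2 := cube2 _ _ Ua Uc.
have h3 := cube2 _ _ Ub Uc.
have := f_equal3 (fun p q r : A => 2%:R^-1 *: (p - q - r)) h1 h2 h3.
rewrite !(scaler0, subr0) => h; apply: (eq_of_null h).
rewrite !(linearDl, linearDr) (mulC b a).
by lmodule_eq K (A : Type) ltac:(field; rewrite ?two_neq0).
Qed.

Lemma fin_gen_finite_dim : finitely_generated A -> finite_dimensional [set: A].
Proof.
move=> [S [/finite_seqP[l ->] lA]].
have /choice[u /choice[v uvP]] (i : 'I_(size l)) := peirce_decomposition l`_i.
pose W (p : 'I_(size l) + 'I_(size l) * 'I_(size l)) : A :=
  match p with inl i => v i | inr ij => u ij.1 ** u ij.2 end.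
have Uu i : U (u i) by case: (uvP i).
have VW p : V (W p).
  by case: p => [i|ij] /=; [case: (uvP i) | apply: UU_V].
have Wuu i j : exists p, W p = u i ** u j by exists (inr (i, j)).
have eU a : U a -> e ** a = 2%:R^-1 *: a by [].
have eV a : V a -> e ** a = 0 by [].
have [s sP] := generated_span two_neq0 mulC UU_V UV_U UVV_skew Uu VW e.
apply/finite_dimensionalP; exists s => x; apply: sP.
(* By minimality of [alg_gen], it suffices that [generated] is a subalgebra containing every
   generator. *)
have : alg_gen [set` l] x by rewrite lA.
apply; split.
  exact: (generated_subalgebra two_neq0 mulC U_zero U_add U_scale UU_V UV_U
    UUV_skew UVV_skew UUU_jacobi Uu VW Wuu eU V_zero V_add V_scale ee eV VV_zero).
move=> y /= /(nthP 0)[i lt_i <-].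
have [_ _ /= ->] := uvP (Ordinal lt_i).
exact: (generators_u_W two_neq0 mulC UU_V UV_U UUV_skew UVV_skew UUU_jacobi
  Uu VW Wuu e _ (Ordinal lt_i) (inl (Ordinal lt_i))).
Qed.

End DegreeTwo.
End Peirce.

Theorem bernstein_degree2_finite_dim (K : fieldType) (A : nalg K) (w : {scalar A}) :
  2%:R != 0 :> K -> 3%:R != 0 :> K -> is_bernstein w -> degrees_le A 2 ->
  finitely_generated A -> finite_dimensional [set: A].
Proof.
move=> h2 h3 bern deg2 fg; have [e ee we] := bernstein_idempotent bern.
exact: (fin_gen_finite_dim h2 h3 bern ee we deg2 fg).
Qed.

(** * Bernstein algebras from two operators *)

Section TwoOperators.
Variables (K : fieldType) (M : lmodType K) (a b : {linear M -> M}).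

Definition pencil (v : K^o * K^o) (x : M) : M := v.1 *: a x + v.2 *: b x.

(** The coordinates are the weight, the component in [M] and the one in K^2. For e = (1, (0, 0)),
    multiplication by [e] is 1/2 on [M] and 0 on K^2. *)
Let B : lmodType K := (K^o * (M * (K^o * K^o)))%type.

Definition pencil_mul (x y : B) : B :=
  (x.1 * y.1,
   (2%:R^-1 *: (x.1 *: y.2.1 + y.1 *: x.2.1) +
      (pencil x.2.2 y.2.1 + pencil y.2.2 x.2.1), 0)).

Lemma pencil_mulC x y : pencil_mul x y = pencil_mul y x.
Proof.
by rewrite /pencil_mul mulrC [X in _ *: X + _]addrC [X in _ + X]addrC.
Qed.

Lemma pencil_mul_linear x : linear (pencil_mul x).
Proof.
move=> k y z; rewrite /pencil_mul; congr pair => /=.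
  by rewrite mulrDr; congr (_ + _); rewrite -[k *: y.1]/(k * y.1) mulrCA.
congr pair; last by rewrite -[RHS]/(k *: (0 : K^o * K^o) + 0) scaler0 addr0.
rewrite /pencil /= !(linearD a) !(linearD b) !(linearZ_LR a) !(linearZ_LR b)
  -?[_ *: (_ : K^o)]/(_ * _) /=.
by lmodule_eq K M ltac:(ring).
Qed.

Lemma pencil_mul_bilinear : bilinear_for *:%R *:%R pencil_mul.
Proof.
split=> x; last exact: pencil_mul_linear.
by move=> k y z; rewrite !(pencil_mulC _ x) pencil_mul_linear.
Qed.

HB.instance Definition _ :=
  bilinear_isBilinear.Build K B B B *:%R *:%R pencil_mul pencil_mul_bilinear.

Definition pencil_alg : nalg K := @NAlg K B pencil_mul.

Definition pencil_weight (x : pencil_alg) : K := x.1.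

Lemma pencil_weight_linear : scalar pencil_weight.
Proof. by []. Qed.

HB.instance Definition _ :=
  GRing.isLinear.Build K pencil_alg K *%R pencil_weight pencil_weight_linear.

Local Notation L := pencil_alg.
Local Notation "x ** y" := (amul L x y) (at level 40, left associativity).
Hypothesis two_neq0 : 2%:R != 0 :> K.

Definition emb (x : M) : L := (0, (x, 0)).

Lemma emb_linear : linear emb.
Proof.
move=> k x y; rewrite /emb; congr pair; last congr pair.
  by rewrite -[RHS]/(k * 0 + 0) mulr0 addr0.
by rewrite -[RHS]/(k *: (0 : K^o * K^o) + 0) scaler0 addr0.
Qed.

HB.instance Definition _ :=
  GRing.isLinear.Build K M L *:%R emb emb_linear.

Lemma pencil_linear v : linear (pencil v).
Proof.
move=> k x y; rewrite /pencil !(linearD a) !(linearD b) !(linearZ_LR a) !(linearZ_LR b).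
by lmodule_eq K M ltac:(ring).
Qed.

HB.instance Definition _ v :=
  GRing.isLinear.Build K M M *:%R (pencil v) (pencil_linear v).

Lemma emb_add x y : emb (x + y) = emb x + emb y.
Proof. exact: linearD. Qed.

Lemma emb_scale k x : emb (k *: x) = k *: emb x.
Proof. exact: linearZ_LR. Qed.

Lemma emb0 : emb 0 = 0. Proof. exact: linear0. Qed.

Lemma pencilD v x y : pencil v (x + y) = pencil v x + pencil v y.
Proof. exact: linearD. Qed.

Lemma pencilZ v k x : pencil v (k *: x) = k *: pencil v x.
Proof. exact: linearZ_LR. Qed.

Lemma pencil0 x : pencil 0 x = 0.
Proof. by rewrite /pencil !scale0r addr0. Qed.

Lemma pencil_sqr (x : L) :
  x ** x = (x.1 ^+ 2, (x.1 *: x.2.1 + 2%:R *: pencil x.2.2 x.2.1, 0)).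
Proof.
rewrite -[LHS]/(pencil_mul x x) /pencil_mul expr2; congr (_, (_, _)).
by lmodule_eq K M ltac:(field; exact: two_neq0).
Qed.

Lemma mul_emb (x : L) z : x ** emb z = emb ((x.1 / 2%:R) *: z + pencil x.2.2 z).
Proof.
rewrite -[LHS]/(pencil_mul x (emb z)) /pencil_mul /emb /= mulr0; congr (_, (_, _)).
by rewrite pencil0; lmodule_eq K M ltac:(field; exact: two_neq0).
Qed.

Lemma mul_sqr (x : L) : x ** (x ** x) =
  x.1 *: (x ** x) + 2%:R *: emb (pencil x.2.2 (pencil x.2.2 x.2.1)).
Proof.
rewrite pencil_sqr; set y := pencil x.2.2 x.2.1.
rewrite -[LHS]/((x.1 * x.1 ^+ 2,
   (2%:R^-1 *: (x.1 *: (x.1 *: x.2.1 + 2%:R *: y) + x.1 ^+ 2 *: x.2.1) +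
      (pencil x.2.2 (x.1 *: x.2.1 + 2%:R *: y) + pencil 0 x.2.1), 0)) : B).
rewrite -[RHS]/((x.1 * x.1 ^+ 2 + 2%:R * 0,
  (x.1 *: (x.1 *: x.2.1 + 2%:R *: y) + 2%:R *: pencil x.2.2 y,
   x.1 *: (0 : K^o * K^o) + 2%:R *: (0 : K^o * K^o))) : B).
rewrite mulr0 addr0 !scaler0 addr0; congr (_, (_, _)).
rewrite pencilD !pencilZ pencil0 -/y.
by lmodule_eq K M ltac:(field; exact: two_neq0).
Qed.

Lemma pencil_algC : is_commutative L.
Proof. exact: pencil_mulC. Qed.

(** A square has no component in K^2, so squaring it again only multiplies it by its weight c^2. *)
Lemma pencil_bernstein : is_bernstein pencil_weight.
Proof.
split=> [x y||x]; first exact: pencil_mulC.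
  split=> //; exists (1, 0); exact: oner_neq0.
rewrite !pencil_sqr /= pencil0 -exprM; congr (_, (_, _)).
  by rewrite -[RHS]/(x.1 ^+ 2 * x.1 ^+ 2) -exprD.
  by rewrite scaler0 addr0.
by rewrite -[RHS]/(x.1 ^+ 2 *: (0 : K^o * K^o)) scaler0.
Qed.

Definition pencil_orbit (x : L) k : L := emb (iter k (pencil x.2.2) x.2.1).

Lemma ppowS (x : L) k : ppow x k.+2 = x ** ppow x k.+1.
Proof. by rewrite pencil_algC. Qed.

Lemma mul_pencil_orbit (x : L) k :
  x ** pencil_orbit x k = (x.1 / 2%:R) *: pencil_orbit x k + pencil_orbit x k.+1.
Proof. by rewrite mul_emb emb_add emb_scale. Qed.

Lemma ppow_null (x : L) k : x.1 = 0 -> ppow x k.+2 = 2%:R *: pencil_orbit x k.+1.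
Proof.
move=> x1; elim: k => [|k IH].
  rewrite -[ppow x 2]/(x ** x) pencil_sqr x1 scale0r add0r expr0n /=.
  rewrite -[RHS]/((2%:R * 0, (2%:R *: pencil x.2.2 x.2.1, 2%:R *: (0 : K^o * K^o))) : L).
  by rewrite mulr0 scaler0.
by rewrite ppowS IH linearZr_LR mul_pencil_orbit x1 mul0r scale0r add0r.
Qed.

Lemma sum_component n (r : 'I_n -> K) (f : 'I_n -> L) :
  (\sum_j r j *: f j).2.1 = \sum_j r j *: (f j).2.1.
Proof. exact: (big_morph (fun y : L => y.2.1) (fun _ _ => erefl) erefl). Qed.

Lemma alg_gen_subalgebra (S : set L) : is_subalgebra (alg_gen S).
Proof.
split=> [|x y Sx Sy|k x Sx|x y Sx Sy] T [T_alg sub_ST]; have [T0 TD TZ TM] := T_alg.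
- exact: T0.
- by apply: TD; [apply: Sx | apply: Sy].
- by apply: TZ; apply: Sx.
- by apply: TM; [apply: Sx | apply: Sy].
Qed.

Lemma alg_gen_sub (S : set L) x : S x -> alg_gen S x.
Proof. by move=> Sx T [_]; apply. Qed.

(** * Upper bounds for degree and rank from a nilpotent pencil *)

Section UpperBound.
Variable d : nat.
Hypotheses (d_ge2 : (2 <= d)%N) (nil : forall v x, iter d (pencil v) x = 0).

(** The list has [d] entries, so once it spans alg(x) it bounds the degree by [d]. *)
Definition monomials (x : L) : seq L :=
  [:: x, x ** x & [seq pencil_orbit x k | k <- iota 2 (d - 2)]].

Lemma orbit_monomials x k : (2 <= k)%N -> inspan (monomials x) (pencil_orbit x k).
Proof.
move=> k2; have [lt_kd|le_dk] := ltnP k d.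
  by apply: inspan_mem; rewrite !inE (map_f (pencil_orbit x)) ?orbT // mem_iota k2 subnKC.
rewrite /pencil_orbit -(subnK le_dk) iterD nil.
have -> : iter (k - d) (pencil x.2.2) 0 = 0 by elim: (k - d)%N => //= n ->; rewrite linear0.
by rewrite linear0; apply: inspan0.
Qed.

(** Only [x] can have a component in K^2: it shifts the orbit, while x^2 and the orbit vectors act
    on [M] by scalars. *)
Lemma monomials_mul x p q : p \in monomials x -> q \in monomials x ->
  inspan (monomials x) (p ** q).
Proof.
have x0 : inspan (monomials x) x by apply: inspan_mem; rewrite inE eqxx.
have x1 : inspan (monomials x) (x ** x) by apply: inspan_mem; rewrite !inE eqxx orbT.
have x2 : inspan (monomials x) (x ** (x ** x)).
  rewrite mul_sqr; apply: inspanD; first exact: inspanZ.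
  by apply: inspanZ; apply: (@orbit_monomials x 2).
have orbE y k : y ** pencil_orbit x k = (y.1 / 2%:R) *: pencil_orbit x k +
    emb (pencil y.2.2 (iter k (pencil x.2.2) x.2.1)).
  by rewrite mul_emb linearD linearZ_LR.
have step y k : y \in monomials x -> (2 <= k)%N -> inspan (monomials x) (y ** pencil_orbit x k).
  move=> + k2; rewrite !inE => /or3P[/eqP->|/eqP->|/mapP[l _ ->]]; rewrite orbE.
  - apply: inspanD; first by apply: inspanZ; apply: orbit_monomials.
    exact: (@orbit_monomials x k.+1 (leqW k2)).
  - rewrite pencil_sqr pencil0 linear0 addr0.
    by apply: inspanZ; apply: orbit_monomials.
  - rewrite pencil0 linear0 addr0.
    by apply: inspanZ; apply: orbit_monomials.
have k2 k : k \in iota 2 (d - 2) -> (2 <= k)%N by rewrite mem_iota => /andP[].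
have x_mem : x \in monomials x by rewrite inE eqxx.
have xx_mem : x ** x \in monomials x by rewrite !inE eqxx orbT.
move=> pm qm; move: (qm); rewrite !inE => /or3P[/eqP qE|/eqP qE|/mapP[l /k2 l2 ->]];
  last exact: step.
  rewrite qE pencil_algC; move: pm; rewrite !inE => /or3P[/eqP->|/eqP->|/mapP[k /k2 kk ->]].
  - exact: x1.
  - exact: x2.
  - exact: step.
rewrite qE pencil_algC; move: pm; rewrite !inE => /or3P[/eqP->|/eqP->|/mapP[k /k2 kk ->]].
- rewrite pencil_algC; exact: x2.
- have [_ _ ->] := pencil_bernstein; apply: inspanZ; exact: x1.
- exact: step.
Qed.

Lemma alg_gen_monomials x y : alg_gen [set x] y -> inspan (monomials x) y.
Proof.
apply; split; last by move=> _ ->; exact: (inspan_mem (mem_head _ _)).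
split; [exact: inspan0|exact: inspanD|exact: inspanZ|].
move=> p q pm qm; move: p pm; apply: inspan_min => [|p p'|k p|p pm].
- by rewrite linear0l; apply: inspan0.
- by rewrite linearDl; apply: inspanD.
- by rewrite linearZl_LR; apply: inspanZ.
move: q qm; apply: inspan_min => [|q q'|k q|q qm].
- by rewrite linear0r; apply: inspan0.
- by rewrite linearDr; apply: inspanD.
- by rewrite linearZr_LR; apply: inspanZ.
exact: monomials_mul.
Qed.

Lemma pencil_degrees_le : degrees_le L d.
Proof.
move=> x; have [S0 SD SZ _] := @alg_gen_subalgebra [set x].
have [m ? le_m] := subspace_has_dim S0 SD SZ (@alg_gen_monomials x).
by exists m => //; rewrite (leq_trans le_m) //= size_map size_iota -addn2 subnK.
Qed.

(** Multiplication by x - c/2, where c is the weight of [x], moves the orbit one step; the base case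
    is x^3 - c x^2 = 2 R^2 u. *)
Lemma orbit_relation k : (2 <= k)%N -> exists2 g : nat -> K, g 0%N = 1 &
  forall x : L, \sum_(0 <= i < k.+1) (g i * x.1 ^+ i) *: ppow x (k.+1 - i) =
    2%:R *: pencil_orbit x k.
Proof.
case: k => [|[|k]] // _; elim: k => [|k [g g0 gP]].
  exists (fun i => if i is 0%N then 1 else if i is 1%N then -1 else 0) => // x.
  rewrite !big_nat_recl // big_geq //= !expr0 expr1 !mul1r !mul0r scale1r !subSS !subn0.
  rewrite ppowS -[ppow x 2]/(x ** x) mul_sqr.
  rewrite -[pencil_orbit x 2]/(emb (pencil x.2.2 (pencil x.2.2 x.2.1))).
  by lmodule_eq K (L : Type) ltac:(ring).
(* [g1] carries the relation multiplied by [x], and [g2] the one multiplied by the weight. The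
   cut-off in [g1] is there because the new last index lies outside the old sum. *)
pose g1 i := if (i <= k.+2)%N then g i else 0.
pose g2 i := if i is i'.+1 then g i' else 0.
exists (fun i => g1 i - 2%:R^-1 * g2 i) => [|x].
  by rewrite /g1 /g2 /= g0 mulr0 subr0.
transitivity (\sum_(0 <= i < k.+4) ((g1 i * x.1 ^+ i) *: ppow x (k.+4 - i) -
    2%:R^-1 *: ((g2 i * x.1 ^+ i) *: ppow x (k.+4 - i)))).
  by apply: eq_bigr => i _; rewrite scalerA mulrBl scalerBl mulrA.
rewrite sumrB -scaler_sumr.
transitivity (x ** (2%:R *: pencil_orbit x k.+2) -
  2%:R^-1 *: (x.1 *: (2%:R *: pencil_orbit x k.+2))).
  congr (_ - _ *: _).
    rewrite big_nat_recr //= {2}/g1 ltnn mul0r scale0r addr0 -gP linear_sumr.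
    apply: eq_big_nat => i /andP[_]; rewrite ltnS => le_i.
    rewrite linearZr_LR /g1 le_i [(k.+4 - i)%N]subSn; last exact: leqW.
    by rewrite [(k.+3 - i)%N]subSn // ppowS.
  rewrite big_nat_recl //= mul0r scale0r add0r -gP scaler_sumr.
  by apply: eq_bigr => i _; rewrite scalerA exprS mulrCA.
rewrite linearZr_LR mul_pencil_orbit.
by lmodule_eq K (L : Type) ltac:(field; exact: two_neq0).
Qed.

Lemma pencil_train : train_equation pencil_weight d.+1.
Proof.
have [g g0 gP] := orbit_relation d_ge2.
exists g => x; have := gP x; rewrite big_ltn // g0 mul1r expr0 scale1r subn0 => ->.
by rewrite /pencil_orbit nil emb0 scaler0.
Qed.

End UpperBound.

(** * Lower bounds from an element of weight 0 *)

Section LowerBound.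
Variables (d : nat) (x0 : M).
Hypotheses (d_gt0 : (0 < d)%N) (nil : iter d a x0 = 0) (nz : iter d.-1 a x0 != 0).

Lemma iter_sum n m (r : 'I_m -> K) (y : 'I_m -> M) :
  iter n a (\sum_j r j *: y j) = \sum_j r j *: iter n a (y j).
Proof.
elim: n => //= n ->; rewrite linear_sum; apply: eq_bigr => j _.
exact: linearZ_LR.
Qed.

Lemma iter_large n : (d <= n)%N -> iter n a x0 = 0.
Proof.
move=> le_dn; rewrite -(subnK le_dn) iterD nil.
by elim: (n - d)%N => //= k ->; rewrite linear0.
Qed.

(** Applying a^(d-1-k) kills the terms beyond index k, those below vanish by induction, and a^(d-1)
    x0 is nonzero. *)
Lemma nilpotent_orbit_free (r : 'I_d -> K) :
  \sum_(j < d) r j *: iter j a x0 = 0 -> forall j, r j = 0.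
Proof.
move=> r0 [k]; elim/ltn_ind: k => k IH lt_kd.
have := congr1 (iter (d.-1 - k) a) r0.
rewrite iter_sum (bigD1 (Ordinal lt_kd)) //= big1 => [|j].
  have -> : iter (d.-1 - k) a 0 = 0 by elim: (_ - _)%N => //= n ->; rewrite linear0.
  rewrite addr0 -iterD subnK; last by rewrite -ltnS prednK.
  by move/eqP; rewrite scaler_eq0 (negbTE nz) orbF => /eqP.
rewrite -val_eqE /= neq_ltn => /orP[lt_jk|lt_kj].
  by case: j lt_jk => j lt_jd /= lt_jk; rewrite IH // scale0r.
rewrite -iterD iter_large ?scaler0 //.
have le_k : (k <= d.-1)%N by rewrite -ltnS prednK.
apply: (@leq_trans (d.-1 - k + k.+1)); last by rewrite leq_add2l.
by rewrite addnS subnK // prednK.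
Qed.

(** With weight 0 and parameter (1, 0), multiplication by [x] restricts to [a] on [M]. *)
Let x : L := (0, (x0, (1, 0))).

Lemma pencil10 y : pencil (1, 0) y = a y.
Proof. by rewrite /pencil scale1r scale0r addr0. Qed.

Lemma pencil_orbit10 k : pencil_orbit x k = emb (iter k a x0).
Proof. by rewrite /pencil_orbit /=; congr emb; apply: eq_iter => y; apply: pencil10. Qed.

Lemma orbit_in_alg_gen k : alg_gen [set x] (pencil_orbit x k.+1).
Proof.
have [_ _ SZ SM] := @alg_gen_subalgebra [set x].
have Sx : alg_gen [set x] x by apply: alg_gen_sub.
have -> : pencil_orbit x k.+1 = 2%:R^-1 *: ppow x k.+2.
  by rewrite ppow_null // scalerA mulVf // scale1r.
by apply: SZ; elim: k => [|k IH]; [apply: SM | rewrite ppowS; apply: SM].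
Qed.

Lemma pencil_degree_ge n : degrees_le L n -> (d <= n)%N.
Proof.
move=> /(_ x)[m dim_m le_mn]; apply: leq_trans le_mn.
(* Index 0 is taken by [x] itself, whose component in [M] is the vector [x0] that starts the
   orbit. *)
pose f (k : 'I_d) : L := if k == 0%N :> nat then x else pencil_orbit x k.
have f21 k : (f k).2.1 = iter k a x0 by rewrite /f pencil_orbit10; case: eqP => // ->.
apply: (@independent_le_dim _ _ _ _ _ f dim_m) => [[[|k] lt_k]|r r0].
- exact: alg_gen_sub.
- exact: orbit_in_alg_gen.
apply: nilpotent_orbit_free.
have := congr1 (fun y : L => y.2.1) r0; rewrite sum_component => h.
by rewrite -[RHS]h; apply: eq_bigr => j _; rewrite f21.
Qed.

(** At weight 0 a train equation of rank n collapses to x^n = 0, where x^n = 2 a^(n-1) x0. *)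
Lemma pencil_train_ge n : (2 <= n)%N -> train_equation pencil_weight n -> (d < n)%N.
Proof.
move=> n_ge2 [g /(_ x)]; rewrite big_nat_cond big1 => [|i /andP[/andP[i0 _] _]]; last first.
  rewrite [X in X *: _](_ : _ = 0) ?scale0r //.
  by rewrite -[LHS]/(g i * (0 : K) ^+ i) expr0n gtn_eqF // mulr0.
rewrite addr0; case: n n_ge2 => [|[|n]] // _.
rewrite ppow_null // pencil_orbit10 => /(congr1 (fun y : L => y.2.1)) /eqP.
rewrite -[X in X == _]/(2%:R *: iter n.+1 a x0) scaler_eq0 (negbTE two_neq0) => /eqP xn.
rewrite ltnNge; apply: contra nz => le_nd; apply/eqP.
have le_n : (n.+1 <= d.-1)%N by rewrite -ltnS prednK.
rewrite -(subnK le_n) iterD xn.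
by elim: (_ - _)%N => //= k ->; rewrite linear0.
Qed.

End LowerBound.

Lemma pencil_infinite_dim :
  (forall n, exists f : 'I_n -> M, forall r : 'I_n -> K,
     \sum_(j < n) r j *: f j = 0 -> forall j, r j = 0) ->
  ~ finite_dimensional [set: L].
Proof.
move=> M_inf [n dim_n]; have [f f_free] := M_inf n.+1.
have := @independent_le_dim _ _ _ _ _ (emb \o f) dim_n (fun _ => I).
rewrite ltnn => /(_ _)/wrap[] // r r0; apply: f_free.
by have := congr1 (fun y : L => y.2.1) r0; rewrite sum_component.
Qed.

Lemma pencil_n_generated (x0 : M) (h : nat -> M) n : (2 <= n)%N -> injective h ->
  (forall P : M -> Prop, P x0 -> (forall x y, P x -> P y -> P (x + y)) ->
     (forall (k : K) x, P x -> P (k *: x)) -> (forall x, P x -> P (a x)) ->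
     (forall x, P x -> P (b x)) -> forall x, P x) ->
  n_generated L n.
Proof.
move=> n_ge2 h_inj M_cyc.
(* The first two elements are e + v1 and x0 + v2. They yield e = (e + v1)^2, then v1, then x0 = 2
   e(x0 + v2), then v2; the remaining entries bring the set to exactly [n] distinct elements. *)
pose f k : L := match k with
  | 0 => (1, (0, (1, 0))) | 1 => (0, (x0, (0, 1))) | k.+2 => emb (h k) end.
exists (f @` `I_n); split.
  apply: inj_card_eq => k l _ _; case: k l => [|[|k]] [|[|l]] //= [].
  - by move=> /eqP; rewrite oner_eq0.
  - by move=> /eqP; rewrite oner_eq0.
  - by move=> /esym /eqP; rewrite oner_eq0.
  - by move=> _ /eqP; rewrite oner_eq0.
  - by move=> /esym /eqP; rewrite oner_eq0.
  - by move=> _ /esym /eqP; rewrite oner_eq0.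
  - by move=> /h_inj ->.
have [S0 SD SZ SM] := @alg_gen_subalgebra (f @` `I_n).
set S := alg_gen _ in S0 SD SZ SM *.
have Sg1 : S (f 0%N) by apply: alg_gen_sub; exists 0%N => //=; apply: leq_trans n_ge2.
have Sg2 : S (f 1%N) by apply: alg_gen_sub; exists 1%N.
pose e : L := (1, (0, 0)); pose v1 : L := (0, (0, (1, 0))).
pose v2 : L := (0, (0, (0, 1))).
have pencil_0r v : pencil v 0 = 0 by rewrite linear0.
have Se : S e.
  suff -> : e = f 0%N ** f 0%N by apply: SM.
  by rewrite pencil_sqr /= pencil_0r !scaler0 addr0 expr1n.
have Sv1 : S v1.
  suff -> : v1 = f 0%N + (-1) *: e by apply: SD => //; apply: SZ.
  rewrite -[RHS]/((1 + (-1) * 1, (0 + (-1) *: 0, (1 + (-1) * 0, 0 + (-1) * 0))) : L).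
  by rewrite mulr1 subrr scaler0 mulr0 !addr0.
have Sx0 : S (emb x0).
  suff -> : emb x0 = 2%:R *: (e ** f 1%N) by apply: SZ; apply: SM.
  rewrite -[RHS]/((2%:R * (1 * 0), (2%:R *: (2%:R^-1 *: (1 *: x0 + 0 *: 0) +
    (pencil 0 x0 + pencil (0, 1) 0)), 2%:R *: (0 : K^o * K^o))) : L).
  rewrite pencil0 pencil_0r mul1r mulr0 !scaler0 !addr0 scale1r scalerA.
  by rewrite mulfV // scale1r.
have Sv2 : S v2.
  suff -> : v2 = f 1%N + (-1) *: emb x0 by apply: SD => //; apply: SZ.
  rewrite -[RHS]/((0 + (-1) * 0, (x0 + (-1) *: x0, (0 + (-1) * 0, 1 + (-1) * 0))) : L).
  by rewrite scaleN1r subrr mulr0 !addr0.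
have Semb y : S (emb y).
  move: y; apply: (M_cyc (fun y => S (emb y))) => // [y z|k y|y|y].
  - by rewrite emb_add; apply: SD.
  - by rewrite emb_scale; apply: SZ.
  - suff -> : emb (a y) = v1 ** emb y by apply: SM.
    by rewrite mul_emb mul0r scale0r add0r pencil10.
  - suff -> : emb (b y) = v2 ** emb y by apply: SM.
    by rewrite mul_emb mul0r scale0r add0r /pencil scale0r add0r scale1r.
apply/seteqP; split=> // -[c [y [p q]]] _.
suff -> : (c, (y, (p, q))) = c *: e + emb y + p *: v1 + q *: v2.
  exact: (SD _ _ (SD _ _ (SD _ _ (SZ _ _ Se) (Semb y)) (SZ _ _ Sv1)) (SZ _ _ Sv2)).
rewrite -[RHS]/((c * 1 + 0 + p * 0 + q * 0,
  (c *: 0 + y + p *: 0 + q *: 0,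
   (c * 0 + 0 + p * 1 + q * 0, c * 0 + 0 + p * 0 + q * 1))) : L).
by rewrite !(mulr1, mulr0, scaler0, addr0, add0r).
Qed.

End TwoOperators.

(** * An infinite-dimensional cyclic nilpotent pencil *)

Section CyclicPencil.
Variables (K : fieldType) (m : nat).
Local Notation M := {poly K}.

(** The space is [{poly K}] with its basis of monomials, on which a linear map is given by arbitrary
    values [f]. *)
Definition basis_map (f : nat -> M) (p : M) : M := \sum_(i < size p) p`_i *: f i.

Lemma basis_map_widen f n (p : M) : (size p <= n)%N ->
  basis_map f p = \sum_(i < n) p`_i *: f i.
Proof.
move=> le_pn; rewrite /basis_map (big_ord_widen n (fun i => p`_i *: f i)) //.
rewrite big_mkcond; apply: eq_bigr => i _; case: ltnP => // le_i.
by rewrite nth_default // scale0r.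
Qed.

Lemma basis_map_linear f : linear (basis_map f).
Proof.
move=> k p q; pose n := maxn (size p) (size q).
have le_n : (size (k *: p + q)%R <= n)%N.
  rewrite (leq_trans (size_polyD _ _)) // geq_max leq_maxr andbT.
  by rewrite (leq_trans (size_scale_leq _ _)) // leq_maxl.
rewrite (basis_map_widen _ le_n) (basis_map_widen f (leq_maxl (size p) (size q))).
rewrite (basis_map_widen f (leq_maxr (size p) (size q))) scaler_sumr -big_split.
by apply: eq_bigr => i _; rewrite coefD coefZ scalerDl scalerA.
Qed.

HB.instance Definition _ f :=
  GRing.isLinear.Build K M M *:%R (basis_map f) (basis_map_linear f).

Lemma basis_mapX f n : basis_map f 'X^n = f n.
Proof.
rewrite (@basis_map_widen f n.+1) ?size_polyXn // big_ord_recr /= coefXn eqxx scale1r.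
rewrite big1 ?add0r // => i _; rewrite coefXn.
by rewrite ltn_eqF ?scale0r.
Qed.

(* The monomial of degree [n < m] is the n-th vector of the chain leading to e1, and
   the one of degree [m + 3 k + r] is [t^k e_(r+1)]. *)
Definition step_a n : M :=
  if (n < m)%N || ((n - m) %% 3 < 2)%N then 'X^(n.+1) else 0.

(** Raising the exponent by 2 leads from remainder 1 or 2 to remainder 0 or 1 in the next block,
    that is, to the next power of t. *)
Definition step_b n : M :=
  if (n < m)%N then 0 else
  match ((n - m) %% 3)%N with 0 => 0 | 1 => 'X^(n.+2) | _ => - 'X^(n.+2) end.

Local Notation a := (basis_map step_a : {linear M -> M}).
Local Notation b := (basis_map step_b : {linear M -> M}).
Local Notation T := (pencil a b).

Let TX v n : T v 'X^n = v.1 *: step_a n + v.2 *: step_b n.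
Proof. by rewrite /pencil /= !basis_mapX. Qed.

Let block k r : (r < 3)%N -> (m + k * 3 + r < m)%N = false /\
  ((m + k * 3 + r - m) %% 3)%N = r.
Proof.
move=> r3; split; first by rewrite -addnA ltnNge leq_addr.
by rewrite -addnA addKn modnMDl modn_small.
Qed.

Lemma pencil_chain v n : (n < m)%N -> T v 'X^n = v.1 *: 'X^(n.+1).
Proof. by move=> lt_nm; rewrite TX /step_a /step_b lt_nm scaler0 addr0. Qed.

Lemma pencil_block0 v k : T v 'X^(m + k * 3) = v.1 *: 'X^((m + k * 3).+1).
Proof.
rewrite TX /step_a /step_b; have := @block k 0 isT; rewrite addn0 => -[-> ->] /=.
by rewrite scaler0 addr0.
Qed.

Lemma pencil_block1 v k : T v 'X^((m + k * 3).+1) =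
  v.1 *: 'X^((m + k * 3).+2) + v.2 *: 'X^(m + k.+1 * 3).
Proof.
rewrite TX /step_a /step_b; have := @block k 1 isT; rewrite addn1 => -[-> ->] /=.
by rewrite mulSn [(3 + _)%N]addnC addnA addn3.
Qed.

Lemma pencil_block2 v k : T v 'X^((m + k * 3).+2) = - v.2 *: 'X^((m + k.+1 * 3).+1).
Proof.
rewrite TX /step_a /step_b; have := @block k 2 isT; rewrite addn2 => -[-> ->] /=.
by rewrite scaler0 add0r mulSn [(3 + _)%N]addnC addnA addn3 scalerN scaleNr.
Qed.

(** For v = (p, q), T e2 = p e3 + q t e1, whose images -pq t e2 and pq t e2 cancel thanks to the
    sign in [step_b]. *)
Lemma pencil_nil_block1 v k : T v (T v 'X^((m + k * 3).+1)) = 0.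
Proof.
rewrite pencil_block1 pencilD !pencilZ pencil_block2 pencil_block0 !scalerA -scalerDl.
by rewrite mulrN mulrC addNr scale0r.
Qed.

Lemma iter_pencil0 v j : iter j (T v) 0 = 0.
Proof. by elim: j => //= j ->; rewrite linear0. Qed.

(** The chain needs m - n steps to reach the first block, and the cube of the pencil vanishes on
    blocks; the subtraction is truncated, so the exponent is 3 there. *)
Lemma pencil_nilX v n : iter (m - n + 3) (T v) 'X^n = 0.
Proof.
have iterZ j k p : iter j (T v) (k *: p) = k *: iter j (T v) p.
  by elim: j => //= j ->; rewrite pencilZ.
have iter_base k : iter 3 (T v) 'X^(m + k * 3) = 0.
  by rewrite /= pencil_block0 !pencilZ pencil_nil_block1 scaler0.
have [lt_nm|le_mn] := ltnP n m.
  rewrite -{2}(subKn (ltnW lt_nm)); move: (m - n)%N (leq_subr n m) => j.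
  elim: j => [_|j IH lt_jm].
    by rewrite subn0; have := iter_base 0; rewrite mul0n addn0.
  rewrite addSn iterSr pencil_chain ?iterZ; last by rewrite ltn_subrL (leq_ltn_trans _ lt_jm).
  by rewrite subnSK // IH ?scaler0 // ltnW.
rewrite (eqP le_mn) add0n -(subnKC le_mn) (divn_eq (n - m) 3) addnA.
move: ((n - m) %/ 3)%N ((n - m) %% 3)%N (ltn_pmod (n - m) (isT : 0 < 3)%N) => k [|[|[|]]] // _.
- by rewrite addn0.
- by rewrite addn1 iterSr iterSr pencil_nil_block1 iter_pencil0.
- by rewrite addn2 iterSr pencil_block2 iterZ iterSr iterSr pencil_nil_block1 scaler0.
Qed.

Lemma basis_pencil_nil v p : iter (m + 3) (T v) p = 0.
Proof.
rewrite -[p]coefK poly_def.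
have iter_lin : iter (m + 3) (T v) (\sum_(i < size p) p`_i *: 'X^i) =
    \sum_(i < size p) p`_i *: iter (m + 3) (T v) 'X^i.
  elim: (m + 3)%N => //= j ->; rewrite linear_sum; apply: eq_bigr => i _.
  exact: pencilZ.
rewrite iter_lin big1 // => i _.
have -> : (m + 3 = (m - (m - i)) + (m - i + 3))%N by rewrite addnA subnK // leq_subr.
by rewrite iterD pencil_nilX iter_pencil0 scaler0.
Qed.

Lemma step_a_iter k : (k <= m + 2)%N -> iter k a 1 = 'X^k.
Proof.
elim: k => [|k IH] le_k; first by rewrite expr0.
rewrite /= IH; last exact: ltnW.
rewrite basis_mapX /step_a.
have [lt_km|le_mk] //= := ltnP k m.
have lt_k2 : (k - m < 2)%N by rewrite ltn_subLR.
by rewrite modn_small ?lt_k2 // (ltn_trans lt_k2).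
Qed.

(** Along the chain and inside a block [a] reaches the next monomial; [b] leads from e2 to the first
    monomial of the next block. *)
Lemma basis_pencil_cyclic (P : M -> Prop) : P 1 ->
  (forall x y, P x -> P y -> P (x + y)) -> (forall (k : K) x, P x -> P (k *: x)) ->
  (forall x, P x -> P (a x)) -> (forall x, P x -> P (b x)) -> forall x, P x.
Proof.
move=> P1 PD PZ Pa Pb x.
have Pblock k : [/\ P 'X^(m + k * 3), P 'X^((m + k * 3).+1) & P 'X^((m + k * 3).+2)].
  have ab j : P 'X^(m + j * 3) -> P 'X^((m + j * 3).+1) /\ P 'X^((m + j * 3).+2).
    move=> Pj; suff Pj1 : P 'X^((m + j * 3).+1).
      split=> //; have := Pa _ Pj1; rewrite /= basis_mapX /step_a.
      by have := @block j 1 isT; rewrite addn1 => -[-> ->].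
    have := Pa _ Pj; rewrite /= basis_mapX /step_a.
    by have := @block j 0 isT; rewrite addn0 => -[-> ->].
  suff Pk : P 'X^(m + k * 3) by split=> //; case: (ab k Pk).
  elim: k => [|k /ab[Pk1 _]].
    rewrite mul0n addn0 -step_a_iter ?leq_addr //.
    by elim: m => //= j; apply: Pa.
  have := Pb _ Pk1; rewrite /= basis_mapX /step_b.
  have := @block k 1 isT; rewrite addn1 => -[-> ->].
  by rewrite mulSn [(3 + _)%N]addnC addnA addn3.
have PX n : P 'X^n.
  have [lt_nm|le_mn] := ltnP n m.
    rewrite -step_a_iter; last by rewrite (leq_trans (ltnW lt_nm)) ?leq_addr.
    by elim: n {lt_nm} => //= j; apply: Pa.
  rewrite -(subnKC le_mn) (divn_eq (n - m) 3) addnA.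
  move: ((n - m) %/ 3)%N ((n - m) %% 3)%N (ltn_pmod (n - m) (isT : 0 < 3)%N) => k [|[|[|]]] // _;
    have [Pk0 Pk1 Pk2] := Pblock k; by rewrite ?addn0 ?addn1 ?addn2.
rewrite -[x]coefK poly_def; elim/big_ind: _ => [|p q|i _].
- by rewrite -(scale0r 1); apply: PZ.
- exact: PD.
- exact: PZ.
Qed.

Lemma polyX_free n (r : 'I_n -> K) : \sum_(j < n) r j *: 'X^j = 0 :> M ->
  forall j, r j = 0.
Proof.
move=> r0 j; have := congr1 (fun p : M => p`_j) r0; rewrite coef0 coef_sum.
rewrite (bigD1 j) //= big1 => [|i ij].
  by rewrite addr0 coefZ coefXn eqxx mulr1.
rewrite coefZ coefXn eq_sym; move: ij; rewrite -val_eqE => /negbTE.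
by move=> ->; rewrite mulr0.
Qed.

End CyclicPencil.

(** * The examples for (b) and (c), with d = m + 3 *)

Section Example.
Variables (K : fieldType) (m : nat).
Hypothesis two_neq0 : 2%:R != 0 :> K.

Let a : {linear {poly K} -> {poly K}} := basis_map (step_a K m).
Let b : {linear {poly K} -> {poly K}} := basis_map (step_b K m).

Let a_nil : iter (m + 3) a 1 = 0.
Proof.
rewrite -(basis_pencil_nil m (1, 0) 1); apply: eq_iter => p.
by rewrite pencil10.
Qed.

Let a_nz : iter (m + 3).-1 a 1 != 0.
Proof. by rewrite addnS step_a_iter // -size_poly_eq0 size_polyXn. Qed.

Lemma example_infinite_dim : ~ finite_dimensional [set: pencil_alg a b].
Proof.
by apply: pencil_infinite_dim => n; exists (fun j => 'X^j) => r; apply: polyX_free.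
Qed.

Lemma example_n_generated n : (2 <= n)%N -> n_generated (pencil_alg a b) n.
Proof.
move=> n_ge2; apply: (pencil_n_generated two_neq0 n_ge2 (h := fun k => 'X^k : {poly K})).
  by move=> i j /(congr1 (fun p : {poly K} => size p)); rewrite !size_polyXn => -[].
exact: basis_pencil_cyclic.
Qed.

Lemma example_bounded_degree : bounded_degree (pencil_alg a b) (m + 3).
Proof.
split=> [||n _]; first by rewrite addnS.
  by apply: pencil_degrees_le => //; [rewrite addnS ltnS addnS | exact: basis_pencil_nil].
by apply: pencil_degree_ge a_nil a_nz _ => //; rewrite addnS.
Qed.

Lemma example_train : is_train (@pencil_weight K _ a b) (m + 3).+1.
Proof.
have [mulC weight _] := pencil_bernstein a b two_neq0.
split=> //; first by rewrite addnS.
  by apply: pencil_train => //; [rewrite addnS ltnS addnS | exact: basis_pencil_nil].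
by move=> n; apply: (pencil_train_ge two_neq0 _ a_nz); rewrite addnS.
Qed.

End Example.

Theorem theorem7p1 (K : fieldType) (Kinf : infinite_set [set: K])
    (Kchar2 : 2%N \notin [pchar K]) (Kchar3 : 3%N \notin [pchar K]) :
  [/\ (* (a) *)
      forall (A : nalg K) (w : {scalar A}),
        is_bernstein w -> finitely_generated A ->
        (exists2 d : nat, bounded_degree A d & (d <= 2)%N) ->
        finite_dimensional [set: A],
      (* (b) *)
      forall d n : nat, (3 <= d)%N -> (2 <= n)%N ->
        exists (A : nalg K) (w : {scalar A}),
          [/\ is_bernstein w, ~ finite_dimensional [set: A],
              n_generated A n & bounded_degree A d]
    & (* (c) *)
      forall d n : nat, (3 <= d)%N -> (2 <= n)%N ->
        exists (A : nalg K) (w : {scalar A}),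
          [/\ is_bernstein w, ~ finite_dimensional [set: A],
              n_generated A n & is_train w d.+1]].
Proof.
have two_neq0 : 2%:R != 0 :> K by move: Kchar2; rewrite inE.
have three_neq0 : 3%:R != 0 :> K by move: Kchar3; rewrite inE.
split=> [A w bern fg [d [_ deg_d _] le_d2]|d n d_ge3 n_ge2|d n d_ge3 n_ge2].
- apply: (bernstein_degree2_finite_dim two_neq0 three_neq0 bern _ fg) => x.
  by have [m dim_m le_m] := deg_d x; exists m; rewrite ?(leq_trans le_m).
- pose m := (d - 3)%N; rewrite -(subnK d_ge3) -/m.
  exists (pencil_alg (basis_map (step_a K m)) (basis_map (step_b K m))).
  exists (@pencil_weight K {poly K} _ _); split.
  + exact: pencil_bernstein two_neq0.
  + exact: example_infinite_dim.
  + exact: example_n_generated two_neq0 _ n_ge2.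
  + exact: example_bounded_degree two_neq0.
- pose m := (d - 3)%N; rewrite -(subnK d_ge3) -/m.
  exists (pencil_alg (basis_map (step_a K m)) (basis_map (step_b K m))).
  exists (@pencil_weight K {poly K} _ _); split.
  + exact: pencil_bernstein two_neq0.
  + exact: example_infinite_dim.
  + exact: example_n_generated two_neq0 _ n_ge2.
  + exact: example_train two_neq0.
Qed.
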